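(* Let $m,n\ge 0$ be integers and let $P=(x_1,x_2,\dots,x_m,y_1,y_2,\dots,y_n)$ be a pretzel projection of a 2-bouquet, where $x_i=1$ for all $1\le i\le m$ and $y_j\ge 2$ for all $1\le j\le n$. Then the trivializing number of $P$ is $$tr(P)=\begin{cases} 2\left\lfloor \frac{m}{2}\right\rfloor & \text{if } n=0,\\[2pt] y_j+\displaystyle\sum_{i=1,\, i\ne j}^{n}(y_i-1) & \text{if } n\ge 1 \text{ and one } y_j \text{ is even},\\[2pt] 2\left\lfloor \frac{m+n}{2}\right\rfloor+\displaystyle\sum_{j=1}^{n}(y_j-1) & \text{if } n\ge 1 \text{ and all } y_i \text{ are odd}.\end{cases}$$
   Context: A 2-bouquet is a rigid-vertex embedding in $\mathbb{R}^3$ of the graph with one 4-valent vertex and two loops (called petals): the vertex is regarded as a rigid disk with four strands attached in a fixed cyclic order. Two diagrams are equivalent if they are related by finitely many extended Reidemeister moves: RI, RII, RIII (the classical moves), RIV (slide a strand entirely over or entirely under the vertex), and RV (flip the rigid vertex by a half-turn, which transfers a crossing between two adjacent strands on one side of the vertex to a crossing of the same slope type between the two strands on the other side); equivalently, the rigid-vertex graphs are ambient isotopic. A precrossing is a transverse double point without over/under information. A projection is a diagram all of whose double points are precrossings; a pseudodiagram is a diagram whose double points may be crossings or precrossings. Resolving a precrossing means replacing it by a crossing of either type. The trivial 2-bouquet of type $K$ is given by the planar diagram without double points, in which each petal leaves and returns to the vertex along two cyclically adjacent strands. The trivial 2-bouquet of type $L$ is given by the diagram with exactly one crossing, in which each petal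 leaves and returns along two opposite strands and the two petals cross once. A pseudodiagram is $K$-trivial (resp. $L$-trivial) if every diagram obtained by resolving all its precrossings is equivalent to the trivial 2-bouquet of type $K$ (resp. type $L$). The trivializing number $tr(Q)$ of a pseudodiagram $Q$ is the minimum number of precrossings that need to be replaced by (suitably chosen) crossings to obtain a $K$-trivial or $L$-trivial pseudodiagram ($\infty$ if this is impossible). Pretzel projection $(x_1,\dots,x_k)$: place $k+1$ disks in a horizontal row. The leftmost disk contains only the 4-valent vertex, with strands leaving at its NW, NE, SW, SE corners. The $i$-th of the remaining disks contains a stack of $x_i$ precrossings placed vertically, i.e. two strands twisted about each other along a vertical axis with $x_i$ double points, with ends at the NW, NE, SW, SE corners. For consecutive disks, the NE corner of the left disk is joined to the NW corner of the next, and the SE corner to the SW corner; the NE and SE corners of the last disk are joined around the diagram to the NW and SW corners, respectively, of the vertex disk. Pretzel projections are always assumed to be projections of a 2-bouquet (no additional closed components); in particular at most one entry is even. By convention, the diagram $(1,1,\dots,1)$ with $m$ entries is identified with the single-stack diagram $(m)$; the diagram with no precrossings is $(0)$. *)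

(* Defs.v *)
From mathcomp Require Import all_boot boolp.
From Stdlib Require Export Relation_Operators.
Set Implicit Arguments.
Unset Strict Implicit.
Unset Printing Implicit Defensive.

(* A plane diagram in general position with respect to the height function is
   cut into horizontal slices, each containing one elementary piece, and is
   encoded as the word of these pieces read from bottom to top.  The letter
   (k, i) is a piece of kind k with exactly i strands to its left.  Plane
   isotopies that change the slicing are part of the moves below.

     Cup             local minimum
     Cap             local maximum
     Dbl (Some true)   crossing, over-strand from lower left to upper right
     Dbl (Some false)  crossing, over-strand from lower right to upper left
     Dbl None          precrossing
     Vtx             rigid vertex, two strands leaving below and two above *)
Inductive kind := Cup | Cap | Dbl of option bool | Vtx.

Definition letter : Type := kind * nat.
Definition word : Type := seq letter.

Definition ar_in (k : kind) : nat := if k is Cup then 0 else 2.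
Definition ar_out (k : kind) : nat := if k is Cap then 0 else 2.

(* Number of strands above w when there are n below; None if some letter does
   not fit. *)
Fixpoint width (n : nat) (w : word) : option nat :=
  if w is (k, i) :: w' then
    if i + ar_in k <= n then width (n - ar_in k + ar_out k) w' else None
  else Some n.

Definition closed (w : word) : Prop := width 0 w = Some 0.

(* A point (t, p) is the p-th strand, from the left, at the height between the
   first t letters and the others; linked points are joined along a strand
   (straight through double points) or at the vertex. *)
Definition is_point (w : word) (a : nat * nat) : Prop :=
  a.1 <= size w /\ exists2 n, width 0 (take a.1 w) = Some n & a.2 < n.

Inductive link (w : word) : nat * nat -> nat * nat -> Prop :=
| link_left u v k i p : w = u ++ (k, i) :: v -> p < i ->
    link w (size u, p) ((size u).+1, p)
| link_right u v k i p : w = u ++ (k, i) :: v ->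
    link w (size u, i + ar_in k + p) ((size u).+1, i + ar_out k + p)
| link_cup u v i : w = u ++ (Cup, i) :: v ->
    link w ((size u).+1, i) ((size u).+1, i.+1)
| link_cap u v i : w = u ++ (Cap, i) :: v ->
    link w (size u, i) (size u, i.+1)
| link_dbl_up u v c i : w = u ++ (Dbl c, i) :: v ->
    link w (size u, i) ((size u).+1, i.+1)
| link_dbl_down u v c i : w = u ++ (Dbl c, i) :: v ->
    link w (size u, i.+1) ((size u).+1, i)
| link_vtx_below u v i : w = u ++ (Vtx, i) :: v ->
    link w (size u, i) (size u, i.+1)
| link_vtx_above u v i : w = u ++ (Vtx, i) :: v ->
    link w ((size u).+1, i) ((size u).+1, i.+1)
| link_vtx_through u v i : w = u ++ (Vtx, i) :: v ->
    link w (size u, i) ((size u).+1, i).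

Definition is_vtx (a : letter) : bool := if a.1 is Vtx then true else false.

(* One 4-valent vertex and, by connectedness, no closed component besides the
   two petals. *)
Definition two_bouquet (w : word) : Prop :=
  [/\ closed w, count is_vtx w = 1
    & forall a b, is_point w a -> is_point w b ->
        clos_refl_sym_trans _ (link w) a b].

Definition X (s : bool) (i : nat) : letter := (Dbl (Some s), i).

(* Local moves; variants obtained by turning a picture follow from the plane
   isotopies, since a quarter turn exchanges the two kinds of crossings and
   fixes the vertex. *)
Inductive rule : word -> word -> Prop :=
(* plane isotopy *)
| iso_far k l i j : i <= j ->
    rule [:: (k, i); (l, j + ar_out k)] [:: (l, j + ar_in k); (k, i)]
| iso_zigzag_l i : rule [:: (Cup, i); (Cap, i.+1)] [::]
| iso_zigzag_r i : rule [:: (Cup, i.+1); (Cap, i)] [::]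
| iso_turn_cap s i : rule [:: X s i; (Cap, i.+1)] [:: X (~~ s) i.+1; (Cap, i)]
| iso_turn_cup s i : rule [:: (Cup, i.+1); X s i] [:: (Cup, i); X (~~ s) i.+1]
| iso_vtx_cap i : rule [:: (Vtx, i); (Cap, i.+1)] [:: (Vtx, i.+1); (Cap, i)]
| iso_vtx_cup i : rule [:: (Cup, i.+1); (Vtx, i)] [:: (Cup, i); (Vtx, i.+1)]
(* extended Reidemeister moves *)
| RI_r s i : rule [:: (Cup, i.+1); X s i; (Cap, i.+1)] [::]
| RI_l s i : rule [:: (Cup, i); X s i.+1; (Cap, i)] [::]
| RII s i : rule [:: X s i; X (~~ s) i] [::]
| RIII s i : rule [:: X s i; X s i.+1; X s i] [:: X s i.+1; X s i; X s i.+1]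
| RIV s i : rule [:: (Vtx, i); X s i.+1; X s i] [:: X s i.+1; X s i; (Vtx, i.+1)]
| RV s i : rule [:: X s i; (Vtx, i)] [:: (Vtx, i); X s i].

(* Both sides must be genuine diagrams: an ill-formed word depicts nothing. *)
Definition move (D E : word) : Prop :=
  [/\ closed D, closed E
    & exists u v l r, [/\ rule l r, D = u ++ l ++ v & E = u ++ r ++ v]].

Definition equivalent : word -> word -> Prop := clos_refl_sym_trans _ move.

Definition trivialK : word := [:: (Cup, 0); (Vtx, 0); (Cap, 0)].

(* Vertex on the left, crossing on the right.  The choice of the crossing is
   immaterial: on the sphere, a quarter turn about the axis through the vertex
   and the crossing exchanges the two diagrams. *)
Definition trivialL : word :=
  [:: (Cup, 0); (Cup, 1); (Vtx, 0); X true 2; (Cap, 1); (Cap, 0)].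

Definition is_pre (a : letter) : bool := if a.1 is Dbl None then true else false.

Definition npre (Q : word) : nat := count is_pre Q.

Definition kind_replaced (k k' : kind) : bool :=
  match k, k' with
  | Cup, Cup | Cap, Cap | Vtx, Vtx | Dbl None, Dbl _ => true
  | Dbl (Some s), Dbl (Some s') => s == s'
  | _, _ => false
  end.

(* Q' is obtained from Q by replacing some precrossings by crossings. *)
Definition replaced (Q Q' : word) : bool :=
  all2 (fun a b : letter => kind_replaced a.1 b.1 && (a.2 == b.2)) Q Q'.

Definition resolution (Q D : word) : Prop := replaced Q D /\ npre D = 0.

Definition K_trivial (Q : word) : Prop :=
  forall D, resolution Q D -> equivalent D trivialK.

Definition L_trivial (Q : word) : Prop :=
  forall D, resolution Q D -> equivalent D trivialL.

Definition trivializable (Q : word) (d : nat) : Prop :=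
  exists Q', [/\ replaced Q Q', npre Q = npre Q' + d
               & K_trivial Q' \/ L_trivial Q'].

(* None stands for infinity. *)
Definition tr (Q : word) : option nat :=
  if pselect (exists d, `[< trivializable Q d >]) is left ex
  then Some (ex_minn ex) else None.

Definition stack (x i : nat) : word := nseq x (Dbl None, i).

(* Disk number j (the vertex being disk 0) occupies the strands 2j and 2j+1.
   Below the disks, a cup joins the SE corner of each disk to the SW corner of
   the next one, and an outermost cup joins the SE corner of the last disk to
   the SW corner of the vertex disk; likewise above, with caps. *)
Definition pretzel_row (xs : seq nat) : word :=
  (Cup, 0) :: nseq (size xs) (Cup, 1)
  ++ (Vtx, 0) :: flatten [seq stack (nth 0 xs j) j.+1.*2 | j <- iota 0 (size xs)]
  ++ nseq (size xs) (Cap, 1) ++ [:: (Cap, 0)].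

(* The empty list denotes the diagram without precrossings, which is (0). *)
Definition pretzel (xs : seq nat) : word :=
  pretzel_row (if xs is [::] then [:: 0] else xs).

(* Main.v *)
(* Upper bound: an alternating stack cancels by RII down to at most one crossing.
   A disk with one crossing next to an empty disk is removed by RI, and two
   neighbouring disks with opposite crossings form a horizontal tangle that
   disappears.

   Lower bound: give every strand a petal, a direction and a Fox colour, the four
   strands at the vertex having the same colour.  The sum of the signs of the
   crossings between the two petals is invariant, 0 for K and +-1 for L; when all
   stacks are odd every crossing counts, so that at most one precrossing can stay
   (none if the bouquet has type K), and when the j-th stack is even exactly its
   crossings count.  In that case a petal is a connected sum of torus knots
   T(2, c), c running over the net numbers of crossings of the odd stacks it goes
   through; two precrossings left in such a stack allow |c| >= 2, and then the
   diagram has a non-constant Fox colouring modulo |c|, which K has not. *)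
From mathcomp Require Import all_boot all_algebra zify ring boolp.
Require Import Defs.
Set Implicit Arguments.
Unset Strict Implicit.
Unset Printing Implicit Defensive.

Import GRing.Theory.

(** * Reducing diagrams *)

(** Switching a crossing between the petals changes the sum of signs by 2. Completing the
    precrossings all by one type or all by the other therefore moves the sum by twice the number of
    counted precrossings: K allows none and L at most one, and parity restricts the type. The vertex
    conditions are those that the vertex moves need. Each petal has one entering and one leaving
    end, so signs balance when a strand slides past the vertex; equal colours there let Fox
    colourings survive RIV and RV. Directions and petal names are not determined by a diagram, so
    the invariant is the set of attainable sums: every labelling of one side of a move has a partner
    with the same boundary on the other side. The colouring that detects |c| > 1 is 1 on the arcs
    between the j-th stack and the offending one and 0 elsewhere; the jump at the j-th stack is
    allowed because type K has already forced its net number of crossings to be 0. Diagrams live in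
    the plane, so carrying an outer arc across infinity is replaced by sliding it past the
    vertex. *)

Lemma width_cat n u v : width n (u ++ v) = obind (width^~ v) (width n u).
Proof. by elim: u n => //= -[k i] u IH n; case: ifP => // _; rewrite IH. Qed.

Lemma rule_width n l r :
  rule l r -> width n l <> None -> width n r = width n l.
Proof.
by case=> [k k' i j ij|i|i|s i|s i|i|i|s i|s i|s i|s i|s i|s i] /=;
  try case: k; try case: k' => /=;
  do ![case: ifP => //= ?]; move=> *; try congr Some; lia.
Qed.

(** An empty [r] fits at any width, while [l] may need strands that are absent; hence the exclusion
    in this direction. *)
Lemma rule_width_rev n l r : r <> [::] ->
  rule l r -> width n r <> None -> width n l = width n r.
Proof.
move=> + lr; case: lr => [k k' i j ij|i|i|s i|s i|i|i|s i|s i|s i|s i|s i|s i] //= _;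
  try case: k; try case: k' => /=;
  do ![case: ifP => //= ?]; move=> *; try congr Some; lia.
Qed.

(* Some rules create strands out of nothing and may not fit in a context; this is
   the directed form of equivalence that is a congruence without side conditions. *)
Record reduces (l r : word) : Prop := Reduces {
  reduces_in_context : forall u v, closed (u ++ l ++ v) ->
    closed (u ++ r ++ v) /\ equivalent (u ++ l ++ v) (u ++ r ++ v) }.

Lemma reduces_refl w : reduces w w.
Proof. by split=> u v c; split=> //; apply: rst_refl. Qed.

Lemma reduces_trans w2 w1 w3 : reduces w1 w2 -> reduces w2 w3 -> reduces w1 w3.
Proof.
move=> [r12] [r23]; split=> u v /r12[/r23[c3 e23] e12].
by split=> //; apply: rst_trans e12 e23.
Qed.

Lemma reduces_ctx u v l r : reduces l r -> reduces (u ++ l ++ v) (u ++ r ++ v).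
Proof. by case=> lr; split=> u' v'; rewrite -!catA !(catA u' u); apply: lr. Qed.

Lemma reduces_cat u u' v v' :
  reduces u u' -> reduces v v' -> reduces (u ++ v) (u' ++ v').
Proof.
move=> ru rv; apply: (@reduces_trans (u' ++ v)); first exact: (@reduces_ctx [::] v _ _ ru).
by have := @reduces_ctx u' [::] _ _ rv; rewrite !cats0.
Qed.

Lemma reduces_cons a w w' : reduces w w' -> reduces (a :: w) (a :: w').
Proof. by apply: (@reduces_cat [:: a] [:: a]); apply: reduces_refl. Qed.

Lemma closed_ctx u v l r : closed (u ++ l ++ v) ->
  (forall n, width n l <> None -> width n r = width n l) -> closed (u ++ r ++ v).
Proof.
rewrite /closed !width_cat; case: (width 0 u) => //= n.
rewrite !width_cat => + lr; case E: (width n l) => [m|] //= <-.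
by rewrite lr ?E.
Qed.

Lemma rule_reduces l r : rule l r -> reduces l r.
Proof.
move=> lr; split=> u v c; have c' := closed_ctx c (fun n => rule_width lr).
by split=> //; apply: rst_step; split=> //; exists u, v, l, r.
Qed.

Lemma rule_reduces_rev l r : r <> [::] -> rule l r -> reduces r l.
Proof.
move=> rn lr; split=> u v c; have c' := closed_ctx c (fun n => rule_width_rev rn lr).
by split=> //; apply/rst_sym/rst_step; split=> //; exists u, v, l, r.
Qed.

Lemma reduces_equivalent D E : reduces D E -> closed D -> equivalent D E.
Proof. by case=> /(_ [::] [::]); rewrite /= !cats0 => /[apply] -[]. Qed.


(* The letters of pretzel_row around the vertex and the stacks. *)
Definition frame (k : nat) (body : word) : word :=
  ((Cup, 0) :: nseq k (Cup, 1)) ++ body ++ (nseq k (Cap, 1) ++ [:: (Cap, 0)]).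

Definition col (p : nat) (c : seq (option bool)) : word := [seq (Dbl o, p) | o <- c].

Fixpoint cols (p : nat) (cs : seq (seq (option bool))) : word :=
  if cs is c :: cs' then col p c ++ cols p.+2 cs' else [::].

Definition row (cs : seq (seq (option bool))) : word :=
  frame (size cs) ((Vtx, 0) :: cols 2 cs).

Lemma cols_cat p cs ds : cols p (cs ++ ds) = cols p cs ++ cols (p + (size cs).*2) ds.
Proof.
elim: cs p => [|c cs IH] p /=; first by rewrite addn0.
by rewrite IH catA doubleS !addnS !addSn.
Qed.

Lemma reduces_frame k b b' : reduces b b' -> reduces (frame k b) (frame k b').
Proof. exact: reduces_ctx. Qed.

Lemma reduces_row cs ds : size cs = size ds ->
  (forall p i, i < size cs -> reduces (col p (nth [::] cs i)) (col p (nth [::] ds i))) ->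
  reduces (row cs) (row ds).
Proof.
move=> eqs rc; rewrite /row eqs; apply/reduces_frame.
apply: reduces_cons; elim: cs ds eqs rc 2 => [|c cs IH] [|d ds] //=.
  by move=> *; apply: reduces_refl.
move=> [/IH{}IH] rc p; apply: reduces_cat; first exact: (rc p 0).
by apply: IH => q i; apply: (rc q i.+1).
Qed.


(** * Isolating the arcs of one gap of a row *)

Lemma far_reduces k l i j : i <= j ->
  reduces [:: (k, i); (l, j + ar_out k)] [:: (l, j + ar_in k); (k, i)].
Proof. by move=> ij; apply: rule_reduces; apply: iso_far. Qed.

Lemma far_reduces_rev k l i j : i <= j ->
  reduces [:: (l, j + ar_in k); (k, i)] [:: (k, i); (l, j + ar_out k)].
Proof. by move=> ij; apply: rule_reduces_rev => //; apply: iso_far. Qed.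

(** The lower arcs lie side by side, so any of them can be drawn last, next to the disks that it
    joins; [j.*2.+1] is the final position of arc [j]. *)
Lemma reduces_cups k j : j <= k ->
  reduces (nseq k.+1 (Cup, 1)) (nseq k (Cup, 1) ++ [:: (Cup, j.*2.+1)]).
Proof.
have eqn n : nseq n.+1 (Cup, 1) = nseq n (Cup, 1) ++ [:: (Cup, 1)].
  by rewrite -addn1 nseqD.
elim: k j => [|k IH] [|j] // jk; try by rewrite eqn; apply: reduces_refl.
rewrite eqn.
apply: (reduces_trans (reduces_cat (IH j jk) (reduces_refl [:: (Cup, 1)]))).
rewrite eqn -!catA; apply: reduces_cat; first exact: reduces_refl.
have := @far_reduces_rev Cup Cup 1 j.*2.+1 isT.
by rewrite /= addn0 addn2 doubleS.
Qed.

Lemma reduces_caps k j : j <= k ->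
  reduces (nseq k.+1 (Cap, 1)) ((Cap, j.*2.+1) :: nseq k (Cap, 1)).
Proof.
elim: k j => [|k IH] [|j] // jk; try exact: reduces_refl.
apply: (reduces_trans (reduces_cons (Cap, 1) (IH j jk))).
have := @far_reduces Cap Cap 1 j.*2.+1 isT; rewrite /= addn0 addn2 -doubleS => r.
exact: (reduces_cat r (reduces_refl (nseq k (Cap, 1)))).
Qed.

Definition slides (q : nat) (a : letter) : bool :=
  (ar_in a.1 == 2) && (ar_out a.1 == 2) && (a.2.+2 <= q).

Lemma reduces_cup_right q w : all (slides q) w ->
  reduces ((Cup, q) :: w) (w ++ [:: (Cup, q)]).
Proof.
elim: w => [_|[k i] w IH /= /andP[/andP[/andP[/eqP ki /eqP ko]] iq /IH{}IH]].
  exact: reduces_refl.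
apply: (@reduces_trans ((k, i) :: (Cup, q) :: w)); last exact: reduces_cons.
apply: (@reduces_cat [:: _; _] [:: _; _]); last exact: reduces_refl.
have := @far_reduces_rev k Cup i (q - 2); rewrite ki ko subnK; last exact: leq_trans iq.
by apply; rewrite leq_subRL ?(leq_trans _ iq).
Qed.

Lemma reduces_cap_left q w : all (slides q) w ->
  reduces (w ++ [:: (Cap, q)]) ((Cap, q) :: w).
Proof.
elim: w => [_|[k i] w IH /= /andP[/andP[/andP[/eqP ki /eqP ko]] iq /IH{}IH]].
  exact: reduces_refl.
apply: (@reduces_trans ((k, i) :: (Cap, q) :: w)); first exact: reduces_cons.
apply: (@reduces_cat [:: _; _] [:: _; _]); last exact: reduces_refl.
have := @far_reduces k Cap i (q - 2); rewrite ki ko subnK; last exact: leq_trans iq.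
by apply; rewrite leq_subRL ?(leq_trans _ iq).
Qed.

Lemma slides_cols q p cs : p + (size cs).*2 <= q -> all (slides q) (cols p cs).
Proof.
elim: cs p => //= c cs IH p; rewrite doubleS => pq; rewrite all_cat IH; last by lia.
by rewrite andbT all_map; apply/allP=> o _; rewrite /= /slides /=; lia.
Qed.

Lemma reduces_cup_cols q p cs : q <= p ->
  reduces ((Cup, q) :: cols p.+2 cs) (cols p cs ++ [:: (Cup, q)]).
Proof.
elim: cs p => [|c cs IH] p qp /=; first exact: reduces_refl.
apply: (@reduces_trans ((col p c ++ [:: (Cup, q)]) ++ cols p.+4 cs)); last first.
  by rewrite -!catA; apply: (reduces_cat (reduces_refl _)); apply: IH; lia.
rewrite -cat_cons; apply: (reduces_cat _ (reduces_refl _)).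
elim: c => [|o c IHc] /=; first exact: reduces_refl.
apply: (@reduces_trans ((Dbl o, p) :: (Cup, q) :: col p.+2 c)); last first.
  exact: reduces_cons.
apply: (@reduces_cat [:: _; _] [:: _; _]); last exact: reduces_refl.
by have := @far_reduces Cup (Dbl o) q p qp; rewrite /= addn2 addn0.
Qed.

Lemma reduces_cap_cols q p cs : q <= p ->
  reduces (cols p.+2 cs ++ [:: (Cap, q)]) ((Cap, q) :: cols p cs).
Proof.
elim: cs p => [|c cs IH] p qp /=; first exact: reduces_refl.
rewrite -catA; apply: (@reduces_trans ((col p.+2 c ++ [:: (Cap, q)]) ++ cols p.+2 cs)).
  by rewrite -!catA; apply: (reduces_cat (reduces_refl _)); apply: IH; lia.
rewrite -cat_cons; apply: (reduces_cat _ (reduces_refl _)).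
elim: c => [|o c IHc] /=; first exact: reduces_refl.
apply: (@reduces_trans ((Dbl o, p.+2) :: (Cap, q) :: col p c)).
  exact: reduces_cons.
apply: (@reduces_cat [:: _; _] [:: _; _]); last exact: reduces_refl.
by have := @far_reduces_rev Cap (Dbl o) q p qp; rewrite /= addn2 addn0.
Qed.

Lemma reduces_frame_gap k j b b' : j <= k ->
  reduces ((Cup, j.*2.+1) :: b ++ [:: (Cap, j.*2.+1)]) b' ->
  reduces (frame k.+1 b) (frame k b').
Proof.
move=> jk bb'; rewrite /frame.
have cups := reduces_cons (Cup, 0) (reduces_cups jk).
have caps := reduces_cat (reduces_caps jk) (reduces_refl [:: (Cap, 0)]).
apply: (reduces_trans (reduces_cat cups (reduces_cat (reduces_refl b) caps))).
rewrite -cat_cons -catA; apply: reduces_cat; first exact: reduces_refl.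
rewrite [X in reduces X](_ : _ =
  ((Cup, j.*2.+1) :: b ++ [:: (Cap, j.*2.+1)]) ++ nseq k (Cap, 1) ++ [:: (Cap, 0)]).
  exact: (reduces_cat bb' (reduces_refl _)).
by rewrite /= -!catA.
Qed.

Lemma reduces_merge A B w p : p = (size A).+1.*2 ->
  reduces (frame (size A + size B).+2 ((Vtx, 0) :: cols 2 A ++ w ++ cols p.+2.+2 B))
          (frame (size A + size B).+1
             ((Vtx, 0) :: cols 2 A ++ ((Cup, p.+1) :: w ++ [:: (Cap, p.+1)]) ++ cols p.+2 B)).
Proof.
move=> pA; apply: (@reduces_frame_gap _ (size A).+1); first by rewrite ltnS leq_addr.
rewrite -pA -![_ :: cols _ _ ++ _]cat_cons; set VA := _ :: cols _ _.
have slA : all (slides p.+1) VA by rewrite /= slides_cols /slides ?pA //=; lia.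
rewrite -!catA; apply: (reduces_trans (reduces_cat (reduces_cup_right slA) (reduces_refl _))).
rewrite -!catA; apply: (reduces_cat (reduces_refl _)).
rewrite /= -catA; apply/reduces_cons/(reduces_cat (reduces_refl _)).
by apply: reduces_cap_cols; lia.
Qed.

(** The arcs of the gap on the left form zigzags with the cap and the cup; straightening them
    removes the disk together with that gap. *)
Lemma reduces_horizontal A B p : p = (size A).+1.*2 ->
  reduces (frame (size A + size B).+1
             ((Vtx, 0) :: cols 2 A ++ [:: (Cap, p); (Cup, p)] ++ cols p.+2 B))
          (frame (size A + size B) ((Vtx, 0) :: cols 2 A ++ cols p B)).
Proof.
move=> pA; apply: (@reduces_frame_gap _ (size A)); first exact: leq_addr.
rewrite -![_ :: cols _ _ ++ _]cat_cons; set VA := _ :: cols _ _.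
have slA : all (slides p) VA by rewrite /= slides_cols /slides ?pA //=; lia.
have cupB := reduces_cup_cols B (leqnn p).
apply: (@reduces_trans ([:: (Cup, (size A).*2.+1); (Cap, p)] ++ VA ++ cols p B
  ++ [:: (Cup, p); (Cap, (size A).*2.+1)])).
  apply/reduces_cons.
  rewrite [X in reduces X](_ : _ = (VA ++ [:: (Cap, p)]) ++
    ((Cup, p) :: cols p.+2 B) ++ [:: (Cap, (size A).*2.+1)]); last by rewrite /= -!catA.
  rewrite [X in reduces _ X](_ : _ = ((Cap, p) :: VA) ++
    (cols p B ++ [:: (Cup, p)]) ++ [:: (Cap, (size A).*2.+1)]); last by rewrite /= -!catA.
  exact: (reduces_cat (reduces_cap_left slA) (reduces_cat cupB (reduces_refl _))).
rewrite {}pA doubleS; apply: (@reduces_trans (VA ++ cols (size A).+1.*2 B ++ [::])).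
  apply: (reduces_cat (rule_reduces (iso_zigzag_l _))).
  by do 2!apply: (reduces_cat (reduces_refl _)); apply/rule_reduces/iso_zigzag_r.
by rewrite cats0 doubleS; apply: reduces_refl.
Qed.

(* Two neighbouring disks with the arcs between them form a single disk, the
   sum of the two tangles. *)
Lemma row_merge A B c1 c2 c3 :
  (forall p, reduces ((Cup, p.+1) :: (col p c1 ++ col p.+2 c2) ++ [:: (Cap, p.+1)])
                     (col p c3)) ->
  reduces (row (A ++ c1 :: c2 :: B)) (row (A ++ c3 :: B)).
Proof.
move=> c123; rewrite /row !size_cat /= !addnS !cols_cat /= (catA (col _ c1)).
have -> : 2 + (size A).*2 = (size A).+1.*2 by rewrite doubleS.
apply: (reduces_trans (@reduces_merge A B _ _ erefl)).
apply/reduces_frame/reduces_cons/reduces_ctx; exact: c123.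
Qed.

Lemma row_loop_right A B s :
  reduces (row (A ++ [:: Some s] :: [::] :: B)) (row (A ++ [::] :: B)).
Proof. by apply: row_merge => p; apply/rule_reduces/RI_r. Qed.

Lemma row_loop_left A B s :
  reduces (row (A ++ [::] :: [:: Some s] :: B)) (row (A ++ [::] :: B)).
Proof. by apply: row_merge => p; apply/rule_reduces/RI_l. Qed.

Lemma row_cancel A B s :
  reduces (row (A ++ [:: Some s] :: [:: Some (~~ s)] :: B)) (row (A ++ B)).
Proof.
rewrite /row !size_cat /= !addnS !cols_cat /=.
have -> : 2 + (size A).*2 = (size A).+1.*2 by rewrite doubleS.
set p := (size A).+1.*2.
apply: (reduces_trans (@reduces_merge A B [:: X s p; X (~~ s) p.+2] _ erefl)).
apply: (reduces_trans _ (@reduces_horizontal A B _ erefl)).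
apply/reduces_frame/reduces_cons/reduces_ctx; rewrite -/p.
(* Turned about the lower and the upper arc of the gap, the two crossings come to lie on top of each
   other in the middle, where RII applies. *)
apply: (reduces_trans (reduces_ctx [::] [:: _; _] (rule_reduces (iso_turn_cup s p)))).
have tc := iso_turn_cap s p.+1.
apply: (reduces_trans (reduces_ctx [:: _; _] [::] (rule_reduces_rev _ tc))) => //.
have r2 := RII (~~ s) p.+1; rewrite negbK in r2.
apply: (reduces_trans (reduces_ctx [:: _] [:: _] (rule_reduces r2))).
by have := @far_reduces Cup Cap p p (leqnn p); rewrite /= addn0 addn2.
Qed.

(** Naming the position [a] lets computation settle every side condition, so that a concrete
    sequence of moves can be replayed line by line. *)
Lemma equivalent_forward a l r D F (E := take a D ++ r ++ drop (a + size l) D) :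
  rule l r -> D = take a D ++ l ++ drop (a + size l) D -> closed D -> closed E ->
  equivalent E F -> equivalent D F.
Proof.
move=> lr eD cD cE; apply: rst_trans; apply: rst_step; split=> //.
by exists (take a D), (drop (a + size l) D), l, r.
Qed.

Lemma equivalent_backward a l r D F (E := take a D ++ l ++ drop (a + size r) D) :
  rule l r -> D = take a D ++ r ++ drop (a + size r) D -> closed D -> closed E ->
  equivalent E F -> equivalent D F.
Proof.
move=> lr eD cD cE; apply: rst_trans; apply/rst_sym/rst_step; split=> //.
by exists (take a D), (drop (a + size r) D), l, r.
Qed.

(** Both diagrams are planar but pair the ends at the vertex differently. An arc is slid past the
    vertex by RIV, and the two kinks that result are removed by RI. *)
Lemma row_nil_equivalent : equivalent (row [:: [::]]) (row [::]).
Proof.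
rewrite /row /frame /=.
apply: (equivalent_backward (a := 1) (iso_zigzag_r 0)) => //=.
apply: (equivalent_forward (a := 3) (iso_vtx_cup 0)) => //=.
apply: (equivalent_backward (a := 5) (RII true 2)) => //=.
apply: (equivalent_backward (a := 6) (iso_turn_cap true 1)) => //=.
apply: (equivalent_forward (a := 4) (RIV true 1)) => //=.
apply: (equivalent_forward (a := 3) (@iso_far Cup (Dbl (Some true)) 0 0 isT)) => //=.
apply: (equivalent_forward (a := 2) (@iso_far Cap (Dbl (Some true)) 0 0 isT)) => //=.
apply: (equivalent_backward (a := 1) (iso_turn_cup false 1)) => //=.
apply: (equivalent_forward (a := 0) (@iso_far Cup Cup 0 0 isT)) => //=.
apply: (equivalent_backward (a := 7) (@iso_far Cap Cap 0 0 isT)) => //=.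
apply: (equivalent_backward (a := 6) (@iso_far Cap Vtx 0 0 isT)) => //=.
apply: (equivalent_forward (a := 1) (RI_l false 0)) => //=.
apply: (equivalent_forward (a := 1) (RI_l true 0)) => //=.
exact: rst_refl.
Qed.

(** After a turn, RV carries the crossing from above the vertex to below it. An arc with a new RI
    kink then slides past the vertex by RIV, another kink disappears, and one crossing is left above
    the vertex, now of the other type. *)
Lemma row_single_equivalent :
  equivalent (row [:: [:: Some false]]) (row [:: [:: Some true]]).
Proof.
rewrite /row /frame /=.
apply: (equivalent_forward (a := 1) (iso_vtx_cup 0)) => //=.
apply: (equivalent_backward (a := 3) (iso_turn_cap true 1)) => //=.
apply: (equivalent_backward (a := 2) (RV true 1)) => //=.
apply: (equivalent_backward (a := 3) (RI_l true 1)) => //=.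
apply: (equivalent_backward (a := 2) (@iso_far Cup (Dbl (Some true)) 1 1 isT)) => //=.
apply: (equivalent_forward (a := 5) (@iso_far Cap Vtx 1 1 isT)) => //=.
apply: (equivalent_backward (a := 3) (RIV true 2)) => //=.
apply: (equivalent_forward (a := 6) (@iso_far Cap Cap 1 2 isT)) => //=.
apply: (equivalent_forward (a := 5) (@iso_far (Dbl (Some true)) Cap 2 2 isT)) => //=.
apply: (equivalent_backward (a := 0) (@iso_far Cup Cup 0 0 isT)) => //=.
apply: (equivalent_backward (a := 1) (@iso_far Cup Cup 1 2 isT)) => //=.
apply: (equivalent_backward (a := 2) (@iso_far Vtx Cup 2 2 isT)) => //=.
apply: (equivalent_forward (a := 3) (RI_r true 3)) => //=.
apply: (equivalent_backward (a := 1) (iso_vtx_cup 1)) => //=.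
apply: (equivalent_forward (a := 0) (@iso_far Cup Cup 0 0 isT)) => //=.
apply: (equivalent_backward (a := 1) (iso_vtx_cup 0)) => //=.
exact: rst_refl.
Qed.

(** * Cancellation in alternating stacks and rows *)

Fixpoint alternating (b : bool) (n : nat) : seq (option bool) :=
  if n is n'.+1 then Some b :: alternating (~~ b) n' else [::].

Lemma size_alternating b n : size (alternating b n) = n.
Proof. by elim: n b => //= n IH b; rewrite IH. Qed.

Definition undecided (c : seq (option bool)) : nat := count_mem None c.

Lemma undecided_alternating b n : undecided (alternating b n) = 0.
Proof. by rewrite /undecided; elim: n b => //= n IH b; rewrite IH. Qed.

Lemma reduces_alternating_even p b n : ~~ odd n ->
  reduces (col p (alternating b n)) [::].
Proof.
rewrite -[n]odd_double_half => /[dup]; rewrite oddD odd_double addbF oddb => /negbTE->.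
rewrite add0n => _; elim: n./2 b => [|m IH] b; first exact: reduces_refl.
rewrite doubleS /= negbK; apply: (@reduces_cat [:: _; _] [::] _ [::]) (IH b).
exact/rule_reduces/RII.
Qed.

Lemma reduces_alternating_odd p b n : odd n ->
  reduces (col p (alternating b n)) (col p [:: Some b]).
Proof. by case: n => //= n en; apply/reduces_cons/reduces_alternating_even. Qed.

Definition single (b : bool) : seq (option bool) := [:: Some b].

(** The empty disk absorbs its neighbours on the right and then on the left, whatever their
    crossings: this is why every odd stack may keep a free precrossing next to an even one. *)
Lemma row_singles us vs :
  reduces (row (map single us ++ [::] :: map single vs)) (row [:: [::]]).
Proof.
apply: (@reduces_trans (row (map single us ++ [:: [::]]))).
  elim: vs => [|v vs]; first exact: reduces_refl.
  by apply: reduces_trans; apply: row_loop_left.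
elim/last_ind: us => [|us u]; first exact: reduces_refl.
by apply: reduces_trans; rewrite map_rcons cat_rcons; apply: row_loop_right.
Qed.

Fixpoint alternating_row (b : bool) (n : nat) : seq (seq (option bool)) :=
  if n is n'.+1 then single b :: alternating_row (~~ b) n' else [::].

Lemma reduces_alternating_row A b n :
  reduces (row (A ++ alternating_row b n.*2)) (row A).
Proof.
elim: n => [|n IH]; first by rewrite cats0; apply: reduces_refl.
by rewrite doubleS /= negbK; apply: (reduces_trans _ IH); apply: row_cancel.
Qed.

(** * Partial resolutions of a row, column by column *)

Definition resolves (o o' : option bool) : bool := (o == None) || (o == o').

Lemma replaced_cat u v D : replaced (u ++ v) D ->
  exists D1 D2, [/\ D = D1 ++ D2, replaced u D1 & replaced v D2].
Proof.
elim: u D => [|a u IH] D /=; first by exists [::], D.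
case: D => // d D /andP[ad /IH[D1 [D2 [-> uD1 vD2]]]].
by exists (d :: D1), D2; split=> //=; apply/andP.
Qed.

Lemma cat_replaced u v D1 D2 :
  replaced u D1 -> replaced v D2 -> replaced (u ++ v) (D1 ++ D2).
Proof. by elim: u D1 => [|a u IH] [|d D1] //= /andP[-> /IH]; apply. Qed.

Definition undotted (a : letter) : bool := if a.1 is Dbl _ then false else true.

Lemma replaced_undotted u D : all undotted u -> replaced u D -> D = u.
Proof.
elim: u D => [|[k i] u IH] [|[l j] D] //= /andP[uk uu] /andP[/andP[kl /eqP /= <-]].
by move=> /(IH _ uu)->; case: k uk kl => //; case: l.
Qed.

Lemma undotted_replaced u : all undotted u -> replaced u u.
Proof. by elim: u => //= -[[||o|] i] u IH //= /IH->; rewrite eqxx. Qed.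

Lemma replaced_col p c D :
  replaced (col p c) D -> exists2 d, D = col p d & all2 resolves c d.
Proof.
elim: c D => [|o c IH] [|[l j] D] //=; first by exists [::].
move=> /andP[/andP[kl /eqP /= <-]] /IH[d -> cd].
have {kl}[o' -> oo'] : exists2 o', l = Dbl o' & resolves o o'.
  by case: o l kl => [b|] [||[b'|]|] //=; [move=> /eqP<- | move=> _ | move=> _];
    [exists (Some b) | exists (Some b') | exists None] => //; rewrite /resolves eqxx.
by exists (o' :: d) => //=; rewrite oo'.
Qed.

Lemma col_replaced p c d : all2 resolves c d -> replaced (col p c) (col p d).
Proof.
elim: c d => [|o c IH] [|o' d] //= /andP[oo /IH->]; rewrite eqxx !andbT.
by case: o oo => [b /eqP<-|] //=.
Qed.

Lemma replaced_row cs D :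
  replaced (row cs) D -> exists2 ds, D = row ds & all2 (all2 resolves) cs ds.
Proof.
rewrite /row /frame => /replaced_cat[D1 [D2 [->]]].
move=> /replaced_undotted->; last by rewrite /= all_nseq orbT.
move=> /replaced_cat[D3 [D4 [->]]] /= r3.
move=> /replaced_undotted->; last by rewrite all_cat all_nseq orbT.
have [D5 -> r5] : exists2 D5, D3 = (Vtx, 0) :: D5 & replaced (cols 2 cs) D5.
  by case: D3 r3 => // -[[] j] //= D3 /andP[/eqP<-]; exists D3.
suff [ds -> cds] : exists2 ds, D5 = cols 2 ds & all2 (all2 resolves) cs ds.
  exists ds => //; rewrite (_ : size cs = size ds) //.
  by elim: cs ds cds {r3 r5} => [|? ? IH] [] //= ? ? /andP[_ /IH->].
elim: cs D5 2 r5 {r3 D} => [|c cs IH] D p /=; first by case: D => // _; exists [::].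
move=> /replaced_cat[E1 [E2 [-> /replaced_col[d -> cd] /IH[ds -> cds]]]].
by exists (d :: ds) => //=; rewrite cd.
Qed.

Lemma row_replaced cs ds :
  all2 (all2 resolves) cs ds -> replaced (row cs) (row ds).
Proof.
move=> cds; rewrite /row /frame.
have -> : size cs = size ds.
  by elim: cs ds cds => [|? ? IH] [] //= ? ? /andP[_ /IH->].
apply: cat_replaced; first by apply: undotted_replaced; rewrite /= all_nseq orbT.
apply: cat_replaced; last by apply: undotted_replaced; rewrite all_cat all_nseq orbT.
rewrite /=; elim: cs ds 2 cds => [|c cs IH] [|d ds] p //= /andP[cd cds].
by apply: cat_replaced; [apply: col_replaced | apply: IH].
Qed.

Lemma npre_row (cs : seq (seq (option bool))) : npre (row cs) = sumn (map undecided cs).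
Proof.
rewrite /npre /row /frame !count_cat /=.
rewrite !count_nseq !mul0n !add0n addn0.
elim: cs 2 => [|c cs IH] p //=; rewrite count_cat IH; congr (_ + _).
by rewrite /undecided count_map; apply: eq_count => -[].
Qed.

Lemma pretzel_rowE xs : pretzel_row xs = row (map (nseq^~ None) xs).
Proof.
rewrite /pretzel_row /row /frame size_map; congr (_ :: _ ++ _ :: _ ++ _).
have -> p : cols p (map (nseq^~ None) xs) =
    flatten [seq stack (nth 0 xs j) (p + j.*2) | j <- iota 0 (size xs)].
  elim: xs p => //= x xs IH p; rewrite addn0 /col /stack map_nseq IH; congr (_ ++ flatten _).
  by rewrite -[1]addn0 iotaDl -map_comp; apply: eq_map => j /=; rewrite doubleS !addnS.
by congr flatten; apply: eq_map => j; rewrite doubleS.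
Qed.

(** * Labellings of strands *)

Section Labelings.

Local Open Scope ring_scope.

Variables (L : eqType) (neg : L -> L) (cross : option bool -> L -> L -> L * L).
Variables (weight : option bool -> L -> L -> int) (vertex : L -> L -> L -> L -> bool).

(** Labels are read upwards, so the two ends of an arc carry [a] and [neg a]. Cups and the vertex
    leave choices open, hence a relation; [n] is the contribution of the letter to the weight. The
    parameters are instantiated once for components and once for petals, directions and colours. *)
Definition passes (k : kind) (s t : seq L) (n : int) : Prop :=
  match k with
  | Cup => exists2 a, t = a :: neg a :: s & n = 0
  | Cap => exists2 a, s = a :: neg a :: t & n = 0
  | Dbl o => exists a b q, [/\ s = [:: a, b & q],
      t = [:: (cross o a b).1, (cross o a b).2 & q] & n = weight o a b]
  | Vtx => exists a b c d q, [/\ s = [:: a, b & q], t = [:: c, d & q],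
      vertex a b c d & n = 0]
  end.

Fixpoint step (k : kind) (i : nat) (s t : seq L) (n : int) : Prop :=
  match i, s, t with
  | 0%N, _, _ => passes k s t n
  | i'.+1, x :: s', y :: t' => x = y /\ step k i' s' t' n
  | _, _, _ => False
  end.

(* ts lists the labels seen at the successive heights above s. *)
Fixpoint trace (w : word) (s : seq L) (ts : seq (seq L)) (n : int) : Prop :=
  match w, ts with
  | [::], [::] => n = 0
  | a :: w', t :: ts' =>
      exists n1 n2, [/\ step a.1 a.2 s t n1, trace w' t ts' n2 & n = n1 + n2]
  | _, _ => False
  end.

Definition reach (w : word) (s t : seq L) (n : int) : Prop :=
  exists2 ts, trace w s ts n & last s ts = t.

Lemma step_at P k i s t n :
  size P = i -> passes k s t n -> step k i (P ++ s) (P ++ t) n.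
Proof. by move=> <- {i} pk; elim: P. Qed.

Lemma step_inv k i s t n : step k i s t n ->
  exists P s' t', [/\ size P = i, s = P ++ s', t = P ++ t' & passes k s' t' n].
Proof.
elim: i s t => [|i IH] s t; first by move=> st; exists [::], s, t.
case: s t => [|x s] [|y t] //= [<- /IH[P [s' [t' [<- -> -> st]]]]].
by exists (x :: P), s', t'.
Qed.

Lemma passes_inv k s t n : passes k s t n ->
  exists ins outs q, [/\ s = ins ++ q, t = outs ++ q,
    size ins = ar_in k, size outs = ar_out k &
    forall q', passes k (ins ++ q') (outs ++ q') n].
Proof.
case: k => [||o|] /=.
- by move=> [a -> ->]; exists [::], [:: a; neg a], s; split=> // q'; exists a.
- by move=> [a -> ->]; exists [:: a; neg a], [::], t; split=> // q'; exists a.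
- move=> [a [b [q [-> -> ->]]]]; exists [:: a; b], [:: (cross o a b).1; (cross o a b).2], q.
  by split=> // q'; exists a, b, q'.
- move=> [a [b [c [d [q [-> -> v ->]]]]]]; exists [:: a; b], [:: c; d], q.
  by split=> // q'; exists a, b, c, d, q'.
Qed.

Lemma trace_cat u v s ts n : trace (u ++ v) s ts n <->
  exists ts1 ts2 n1 n2, [/\ ts = ts1 ++ ts2, trace u s ts1 n1,
    trace v (last s ts1) ts2 n2 & n = n1 + n2].
Proof.
elim: u s ts n => [|a u IH] s ts n /=.
  split=> [h|]; first by exists [::], ts, 0, n; rewrite add0r.
  by move=> [[|? ?] [ts2 [n1 [n2 [-> // -> h ->]]]]]; rewrite add0r.
case: ts => [|t ts].
  by split=> //; move=> [[|? ?] [ts2 [n1 [n2 [//]]]]].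
split.
  move=> [n1 [m [sa /IH[ts1 [ts2 [n2 [n3 [-> h1 h2 ->]]]]] ->]]].
  by exists (t :: ts1), ts2, (n1 + n2), n3; rewrite addrA; split=> //; exists n1, n2.
move=> [[|t' ts1] [ts2 [m [n3 [//= [-> ->] [n1 [n2 [sa h1 ->]]] h2 ->]]]]].
exists n1, (n2 + n3); rewrite addrA; split=> //.
by apply/IH; exists ts1, ts2, n2, n3.
Qed.

Lemma reach_cat u v s t x n m :
  reach u s t n -> reach v t x m -> reach (u ++ v) s x (n + m).
Proof.
move=> [ts1 h1 <-] [ts2 h2 <-]; exists (ts1 ++ ts2); last by rewrite last_cat.
by apply/trace_cat; exists ts1, ts2, n, m.
Qed.

Lemma reach_nil s t n : s = t -> n = 0 -> reach [::] s t n.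
Proof. by move=> -> ->; exists [::]. Qed.

(** The total [m] is fixed beforehand and each letter subtracts its share, so that building a trace
    letter by letter leaves a single numerical equation at the end. *)
Lemma reach_cons k i w s t x n m :
  step k i s t n -> reach w t x (m - n) -> reach ((k, i) :: w) s x m.
Proof.
move=> st [ts h <-]; exists (t :: ts) => //=.
by exists n, (m - n); split=> //; rewrite addrC subrK.
Qed.

Lemma reach_dbl0 o w a b s x m :
  reach w [:: (cross o a b).1, (cross o a b).2 & s] x (m - weight o a b) ->
  reach ((Dbl o, 0%N) :: w) [:: a, b & s] x m.
Proof. by apply: reach_cons; exists a, b, s. Qed.

Lemma reach_dbl1 o w e a b s x m :
  reach w [:: e, (cross o a b).1, (cross o a b).2 & s] x (m - weight o a b) ->
  reach ((Dbl o, 1%N) :: w) [:: e, a, b & s] x m.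
Proof. by apply: reach_cons; split=> //; exists a, b, s. Qed.

Lemma reach_cup0 a w s x m :
  reach w [:: a, neg a & s] x m -> reach ((Cup, 0%N) :: w) s x m.
Proof.
by rewrite -[X in reach w _ _ X]subr0; apply: reach_cons; exists a.
Qed.

Lemma reach_cup1 a w e s x m :
  reach w [:: e, a, neg a & s] x m -> reach ((Cup, 1%N) :: w) (e :: s) x m.
Proof.
by rewrite -[X in reach w _ _ X]subr0; apply: reach_cons; split=> //; exists a.
Qed.

Lemma reach_cap0 w a b s x m :
  b = neg a -> reach w s x m -> reach ((Cap, 0%N) :: w) [:: a, b & s] x m.
Proof.
by move=> ->; rewrite -[X in reach w _ _ X]subr0; apply: reach_cons; exists a.
Qed.

Lemma reach_cap1 w e a b s x m :
  b = neg a -> reach w (e :: s) x m -> reach ((Cap, 1%N) :: w) [:: e, a, b & s] x m.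
Proof.
move=> ->; rewrite -[X in reach w _ _ X]subr0; apply: reach_cons.
by split=> //; exists a.
Qed.

Lemma reach_vtx0 c d w a b s x m : vertex a b c d ->
  reach w [:: c, d & s] x m -> reach ((Vtx, 0%N) :: w) [:: a, b & s] x m.
Proof.
move=> v; rewrite -[X in reach w _ _ X]subr0; apply: reach_cons.
by exists a, b, c, d, s.
Qed.

Lemma reach_vtx1 c d w e a b s x m : vertex a b c d ->
  reach w [:: e, c, d & s] x m -> reach ((Vtx, 1%N) :: w) [:: e, a, b & s] x m.
Proof.
move=> v; rewrite -[X in reach w _ _ X]subr0; apply: reach_cons.
by split=> //; exists a, b, c, d, s.
Qed.

Lemma reach_step k i s t n : step k i s t n -> reach [:: (k, i)] s t n.
Proof. by move=> st; apply: (reach_cons st); apply: reach_nil; rewrite ?subrr. Qed.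

Lemma step_width k i s t n : step k i s t n ->
  (i + ar_in k <= size s)%N /\ size t = (size s - ar_in k + ar_out k)%N.
Proof.
move=> /step_inv[P [s' [t' [<- -> -> /passes_inv[ins [outs [q [-> -> <- <- _]]]]]]]].
by rewrite !size_cat; lia.
Qed.

Lemma trace_width w s ts n :
  trace w s ts n -> width (size s) w = Some (size (last s ts)).
Proof.
elim: w s ts n => [|[k i] w IH] s [|t ts] //= n.
by move=> [n1 [n2 [/step_width[-> <-] /IH]]].
Qed.

Definition shift (p : nat) (w : word) : word := [seq (a.1, p + a.2)%N | a <- w].

Lemma step_shift P k i s t n :
  step k i s t n -> step k (size P + i) (P ++ s) (P ++ t) n.
Proof. by move=> st; elim: P. Qed.

Lemma reach_shift P w s t n :
  reach w s t n -> reach (shift (size P) w) (P ++ s) (P ++ t) n.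
Proof.
move=> [ts tw <-]; exists (map (cat P) ts); last by rewrite last_map.
elim: w s ts n tw => [|[k i] w IH] s [|t' ts] //= n [n1 [n2 [st /IH tw ->]]].
by exists n1, n2; split=> //; apply: step_shift.
Qed.

Lemma cols_shift p q cs : cols (p + q) cs = shift p (cols q cs).
Proof.
elim: cs q => //= c cs IH q; rewrite /shift map_cat -[map _ (cols _ _)]/(shift p _) -IH !addnS.
congr (_ ++ _).
by rewrite /col -map_comp.
Qed.

Fixpoint thread (c : seq (option bool)) (a b : L) : L * L :=
  if c is o :: c' then thread c' (cross o a b).1 (cross o a b).2 else (a, b).

Fixpoint thread_weight (c : seq (option bool)) (a b : L) : int :=
  if c is o :: c' then
    weight o a b + thread_weight c' (cross o a b).1 (cross o a b).2
  else 0.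

Lemma reach_col c a b s : reach (col 0 c) [:: a, b & s]
  [:: (thread c a b).1, (thread c a b).2 & s] (thread_weight c a b).
Proof.
elim: c a b => [|o c IH] a b /=; first exact: reach_nil.
apply: (@reach_cons _ _ _ _ [:: (cross o a b).1, (cross o a b).2 & s] _ (weight o a b)).
  by exists a, b, s.
by rewrite addrAC subrr add0r; apply: IH.
Qed.

(** * Labellings of pretzel rows *)

Hypothesis negK : involutive neg.

Fixpoint arcs (g : nat -> L) (i n : nat) : seq L :=
  if n is n'.+1 then [:: g i, neg (g i) & arcs g i.+1 n'] else [::].

Fixpoint disks (g : nat -> L) (i n : nat) : seq L :=
  if n is n'.+1 then [:: neg (g i), g i.+1 & disks g i.+1 n'] else [::].

(** Gap [k] is the outermost arc: [g k] sits at its right end, so [neg (g k)] comes first. *)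
Definition bottom (g : nat -> L) (k : nat) : seq L := neg (g k) :: arcs g 0 k ++ [:: g k].

(** The same labels grouped by arcs, as the cups produce them, and by disks, as the stacks consume
    them. *)
Lemma arcs_disks g i n : arcs g i n ++ [:: g (i + n)%N] = g i :: disks g i n.
Proof.
elim: n i => [|n IH] i /=; first by rewrite addn0.
by rewrite addnS -addSn IH.
Qed.

Lemma bottomE g k : bottom g k = [:: neg (g k), g 0%N & disks g 0 k].
Proof. by rewrite /bottom -[X in g X :: nil]add0n arcs_disks. Qed.

Lemma mem_bottom g k i : (i < k)%N -> g i \in bottom g k.
Proof.
move=> ik; rewrite inE mem_cat; suff -> : g i \in arcs g 0 k by rewrite orbT.
rewrite -[i]add0n; elim: k i 0%N ik => // k IH [|i] t; first by rewrite addn0 mem_head.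
by rewrite ltnS addnS -addSn !inE => /IH->; rewrite !orbT.
Qed.

Lemma reach_cups g i n x s :
  reach (nseq n (Cup, 1%N)) (x :: s) (x :: arcs g i n ++ s) 0.
Proof.
elim: n i => [|n IH] i; first exact: reach_nil.
rewrite -addn1 nseqD addn1 -[0]addr0; apply: (reach_cat (IH i.+1)).
by apply: reach_step; split=> //; exists (g i).
Qed.

Lemma reach_caps g i n x s :
  reach (nseq n (Cap, 1%N)) (x :: arcs g i n ++ s) (x :: s) 0.
Proof.
elim: n i => [|n IH] i; first exact: reach_nil.
apply: (@reach_cons _ _ _ _ (x :: arcs g i.+1 n ++ s) _ 0); last by rewrite subr0.
by split=> //; exists (g i).
Qed.

Definition row_weight (g : nat -> L) (cs : seq (seq (option bool))) : int :=
  \sum_(i < size cs) thread_weight (nth [::] cs i) (neg (g i)) (g i.+1).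

Lemma reach_cols g h i cs :
  (forall j, (j < size cs)%N -> thread (nth [::] cs j) (neg (g (i + j)%N)) (g (i + j).+1)
     = (neg (h (i + j)%N), h (i + j).+1)) ->
  reach (cols 0 cs) (disks g i (size cs)) (disks h i (size cs))
    (\sum_(j < size cs) thread_weight (nth [::] cs j) (neg (g (i + j)%N)) (g (i + j).+1)).
Proof.
elim: cs i => [|c cs IH] i gh /=; first by apply: reach_nil; rewrite ?big_ord0.
rewrite big_ord_recl /= addn0.
have := reach_col c (neg (g i)) (g i.+1) (disks g i.+1 (size cs)).
have := gh 0%N isT; rewrite /= addn0 => -> /= /reach_cat; apply.
rewrite (cols_shift 2 0); apply: (@reach_shift [:: neg (h i); h i.+1]).
rewrite (eq_bigr (fun j : 'I_(size cs) => thread_weight (nth [::] cs j)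
  (neg (g (i.+1 + j)%N)) (g (i.+1 + j).+1))) => [|j _]; last by rewrite /bump /= add1n addnS.
apply: IH => j js.
by rewrite addSnnS; apply: (gh j.+1).
Qed.

(* The arc in gap i, between disks i and i + 1, has left end labelled g i below the
   disks and h i above them; gap k closes up around the diagram. *)
Definition row_labeling (g h : nat -> L) (cs : seq (seq (option bool))) : Prop :=
  let k := size cs in
  vertex (neg (g k)) (g 0%N) (neg (h k)) (h 0%N) /\
  forall i, (i < k)%N ->
    thread (nth [::] cs i) (neg (g i)) (g i.+1) = (neg (h i), h i.+1).

(** The membership of [bottom] exposes the labels of all lower arcs at one height, where a
    non-constant labelling becomes visible. *)
Lemma trace_row g h cs : row_labeling g h cs ->
  exists ts, [/\ trace (row cs) [::] ts (row_weight g cs), last [::] ts = [::]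
               & bottom g (size cs) \in ts].
Proof.
move=> [vgh cgh]; set k := size cs in vgh cgh *.
have [ts1 h1 l1] : reach ((Cup, 0%N) :: nseq k (Cup, 1%N)) [::] (bottom g k) 0.
  apply: (@reach_cons _ _ _ _ [:: neg (g k); g k] _ 0); last first.
    by rewrite subr0; apply: (reach_cups g 0 k (neg (g k)) [:: g k]).
  by exists (neg (g k)); rewrite ?negK.
have : reach ([:: (Vtx, 0%N)] ++ cols 2 cs) (bottom g k) (bottom h k) (0 + row_weight g cs).
  rewrite !bottomE; apply: (@reach_cat _ _ _ [:: neg (h k), h 0%N & disks g 0 k]).
    by apply: reach_step; exists (neg (g k)), (g 0%N), (neg (h k)), (h 0%N), (disks g 0 k).
  rewrite (cols_shift 2 0); apply: (@reach_shift [:: neg (h k); h 0%N]).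
  exact: (@reach_cols g h 0%N cs).
rewrite add0r => /reach_cat/(_ (_ : reach (nseq k (Cap, 1%N) ++ [:: (Cap, 0%N)]) _ [::] 0))[].
  rewrite -[0]addr0; apply: reach_cat (reach_caps _ _ _ _ _) _.
  by apply: reach_step; exists (neg (h k)); rewrite // negK.
rewrite addr0 => ts2 h2 l2; exists (ts1 ++ ts2); split; last 1 first.
- case: ts1 h1 l1 => // t ts1 _ <-; rewrite mem_cat /= mem_last //.
- rewrite /row /frame; apply/trace_cat; exists ts1, ts2, 0, (row_weight g cs).
  by rewrite add0r l1; split.
- by rewrite last_cat l1.
Qed.

End Labelings.

(** * Petals, directions and Fox colours *)

Section Soundness.

Local Open Scope ring_scope.

Variable M : comNzRingType.

(* The petal, and whether it is followed upwards. *)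
Definition charge : Type := bool * bool.

Definition opp (c : charge) : charge := (c.1, ~~ c.2).

Definition label : Type := charge * M.

Definition rev_label (a : label) : label := (opp a.1, a.2).

Definition sgn (b : bool) : int := if b then 1 else -1.

Definition cross_label (o : option bool) (a b : label) : label * label :=
  match o with
  | Some true => ((b.1, a.2 + a.2 - b.2), a)
  | Some false => (b, (a.1, b.2 + b.2 - a.2))
  | None => (b, a)
  end.

(** Two upward strands cross positively at [Some true]; reversing either of them changes the
    sign. *)
Definition sign (o : option bool) (a b : label) : int :=
  if o is Some s then
    if a.1.1 == b.1.1 then 0 else sgn (s (+) a.1.2 (+) b.1.2)
  else 0.

(** Charges are compared as seen when leaving the vertex, whence [opp] for the strands below. There
    are only four charges, so distinctness means that each petal has one outgoing and one incoming
    end, in any cyclic order. *)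
Definition vertex_label (a b c d : label) : bool :=
  uniq [:: c.1; d.1; opp a.1; opp b.1] && [&& a.2 == b.2, c.2 == b.2 & d.2 == b.2].

Notation trace := (trace rev_label cross_label sign vertex_label).
Notation reach := (reach rev_label cross_label sign vertex_label).

Definition mono (x : M) (s : seq label) : bool := all (fun a => a.2 == x) s.

(** The clause on [mono] controls the labels inside [l], which are lost in passing to [r]. The width
    condition serves moves out of the empty word: they need strands on which the new piece can be
    drawn. *)
Definition sound (l r : word) : Prop := forall s ts n,
  trace l s ts n -> width (size s) r <> None ->
  reach r s (last s ts) n /\
  (forall x, mono x s -> mono x (last s ts) -> all (mono x) ts).

Lemma rev_labelK : involutive rev_label.
Proof. by case=> [[p d] x]; rewrite /rev_label /opp /= negbK. Qed.

Lemma double_sub (x y : M) : x = x + x - y -> y = x.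
Proof.
move=> e; apply/esym/eqP; rewrite -subr_eq0; apply/eqP/(addrI x).
by rewrite addr0 addrA -e.
Qed.

Lemma double_sub_inj (x y z : M) : x + x - y = x + x - z -> y = z.
Proof. by move/addrI/oppr_inj. Qed.

(** Turns a trace through a concrete word into equations between labels; the Fox relations are
    solved by cancellations that never divide by 2. *)
Ltac invert := repeat (simpl in *; match goal with
  | H : ex _ |- _ => destruct H
  | H : ex2 _ _ |- _ => destruct H
  | H : and3 _ _ _ |- _ => destruct H
  | H : and4 _ _ _ _ |- _ => destruct H
  | H : and _ _ |- _ => destruct H
  | H : False |- _ => destruct H
  | x : label |- _ => destruct x as [[? ?] ?]
  | x : (bool * bool * _)%type |- _ => destruct x as [[? ?] ?]
  | H : match ?x with _ => _ end |- _ => destruct x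
  | H : _ :: _ = _ :: _ |- _ => injection H; clear H; intros
  | H : (_, _) = (_, _) |- _ => injection H; clear H; intros
  | H : rev_label _ = _ |- _ => rewrite /rev_label /opp in H
  | H : _ = rev_label _ |- _ => rewrite /rev_label /opp in H
  | H : is_true (vertex_label _ _ _ _) |- _ =>
      let u := fresh "u" in case/andP: H => u /and3P[/eqP ? /eqP ? /eqP ?]
  | H : is_true (_ && _) |- _ => case/andP: H => ? ?
  | H : is_true (_ == _) |- _ => move/eqP: H => ?
  | H : ?x = ?x |- _ => clear H
  | H : ?x = _ |- _ => is_var x; subst x
  | H : _ = ?x |- _ => is_var x; subst x
  | H : ?x = ?x + ?x - ?y |- _ => apply double_sub in H
  | H : ?x + ?x - ?y = ?x + ?x - ?z |- _ => apply double_sub_inj in H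
  | H : ?x + ?x - ?y = ?x |- _ => apply esym, double_sub in H
  | H : nil = _ :: _ |- _ => discriminate H
  | H : _ :: _ = nil |- _ => discriminate H
  end).

Ltac bools := repeat match goal with b : bool |- _ => destruct b end.

Ltac labels := rewrite /rev_label /opp /= ?negbK;
  repeat match goal with
    | |- _ :: _ = _ :: _ => congr (_ :: _)
    | |- (_, _) = (_, _) => congr (_, _)
  end; rewrite ?negbK; try ring; try (bools; done).

Ltac nil := apply: reach_nil; [by labels | by bools].

Ltac mono := let x := fresh "x" in let h := fresh "h" in let h' := fresh "h'" in
  intros x h h'; invert; rewrite /mono /=;
  repeat match goal with |- is_true (_ && _) => apply/andP; split end;
  try done; try assumption; try (apply/eqP; ring).

Ltac vtx := rewrite /vertex_label /=; apply/andP; split;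
  [by bools | by apply/and3P; split; apply/eqP; ring].

Lemma trivialK_trace ts n :
  trace trivialK [::] ts n -> n = 0 /\ exists x, all (mono x) ts.
Proof.
move=> h; invert; split=> //; match goal with x : _ |- _ => exists x end.
by rewrite /mono /= !eqxx.
Qed.

(** The petals meet in one crossing, whose sign depends on the directions chosen. *)
Lemma trivialL_trace ts n : trace trivialL [::] ts n -> n = 1 \/ n = -1.
Proof. by move=> h; invert; bools => //; (left + right). Qed.

Lemma sound_zigzag_l : sound [:: (Cup, 0%N); (Cap, 1%N)] [::].
Proof. by move=> s ts n h _; invert; split; [nil | mono]. Qed.

Lemma sound_zigzag_l_rev : sound [::] [:: (Cup, 0%N); (Cap, 1%N)].
Proof.
move=> [|a s] ts n h // _; invert; split; last by mono.
apply: (reach_cup0 (a := (b, b0, s0))); apply: reach_cap1; first by labels.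
by nil.
Qed.

Lemma sound_zigzag_r : sound [:: (Cup, 1%N); (Cap, 0%N)] [::].
Proof. by move=> s ts n h _; invert; split; [nil | mono]. Qed.

Lemma sound_zigzag_r_rev : sound [::] [:: (Cup, 1%N); (Cap, 0%N)].
Proof.
move=> [|a s] ts n h // _; invert; split; last by mono.
apply: (reach_cup1 (a := (b, ~~ b0, s0))); apply: reach_cap0; first by labels.
by nil.
Qed.

Lemma sound_turn_cap s :
  sound [:: X s 0; (Cap, 1%N)] [:: X (~~ s) 1; (Cap, 0%N)].
Proof.
by move=> t ts n h _; case: s h => h; invert; (split; last by mono);
  apply: reach_dbl1; (apply: reach_cap0; first by labels); nil.
Qed.

Lemma sound_turn_cap_rev s :
  sound [:: X (~~ s) 1; (Cap, 0%N)] [:: X s 0; (Cap, 1%N)].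
Proof.
by move=> t ts n h _; case: s h => h; invert; (split; last by mono);
  apply: reach_dbl0; (apply: reach_cap1; first by labels); nil.
Qed.

Lemma sound_turn_cup s :
  sound [:: (Cup, 1%N); X s 0] [:: (Cup, 0%N); X (~~ s) 1].
Proof.
move=> t ts n h _; case: s h => h; invert; (split; last by mono); match goal with
  |- reach _ _ (?a :: _) _ => apply: (reach_cup0 (a := a)) end;
  apply: reach_dbl1; nil.
Qed.

Lemma sound_turn_cup_rev s :
  sound [:: (Cup, 0%N); X (~~ s) 1] [:: (Cup, 1%N); X s 0].
Proof.
move=> t ts n h _; case: s h => h; invert; (split; last by mono); match goal with
  |- reach _ _ [:: _, _, ?a & _] _ => apply: (reach_cup1 (a := rev_label a)) end;
  apply: reach_dbl0; nil.
Qed.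

Lemma sound_vtx_cap : sound [:: (Vtx, 0%N); (Cap, 1%N)] [:: (Vtx, 1%N); (Cap, 0%N)].
Proof.
move=> t ts n h _; invert; (split; last by mono); match goal with
  |- reach _ (?a :: _) (?c :: _) _ =>
    apply: (reach_vtx1 (c := rev_label a) (d := c)); first by vtx end.
by apply: reach_cap0; [labels | nil].
Qed.

Lemma sound_vtx_cap_rev : sound [:: (Vtx, 1%N); (Cap, 0%N)] [:: (Vtx, 0%N); (Cap, 1%N)].
Proof.
move=> t ts n h _; invert; (split; last by mono); match goal with
  |- reach _ [:: _, _, ?e & _] (?c :: _) _ =>
    apply: (reach_vtx0 (c := c) (d := rev_label e)); first by vtx end.
by apply: reach_cap1; [labels | nil].
Qed.

Lemma sound_vtx_cup : sound [:: (Cup, 1%N); (Vtx, 0%N)] [:: (Cup, 0%N); (Vtx, 1%N)].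
Proof.
move=> t ts n h _; invert; (split; last by mono); match goal with
  |- reach _ _ [:: ?c, ?d, ?e & _] _ =>
    apply: (reach_cup0 (a := c)); apply: (reach_vtx1 (c := d) (d := e)); first by vtx end.
by nil.
Qed.

Lemma sound_vtx_cup_rev : sound [:: (Cup, 0%N); (Vtx, 1%N)] [:: (Cup, 1%N); (Vtx, 0%N)].
Proof.
move=> t ts n h _; invert; (split; last by mono); match goal with
  |- reach _ _ [:: ?z, ?c, ?d & _] _ =>
    apply: (reach_cup1 (a := rev_label d)); apply: (reach_vtx0 (c := z) (d := c)); first by vtx end.
by nil.
Qed.

Lemma sound_RI_r s : sound [:: (Cup, 1%N); X s 0; (Cap, 1%N)] [::].
Proof. by move=> t ts n h _; case: s h => h; invert; (split; [nil | mono]). Qed.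

Lemma sound_RI_r_rev s : sound [::] [:: (Cup, 1%N); X s 0; (Cap, 1%N)].
Proof.
move=> [|a t] ts n h // _; invert; split; last by mono.
apply: (reach_cup1 (a := (b, b0, s0))); apply: reach_dbl0.
by case: s => /=; apply: reach_cap1; [labels | nil | labels | nil].
Qed.

Lemma sound_RI_l s : sound [:: (Cup, 0%N); X s 1; (Cap, 0%N)] [::].
Proof. by move=> t ts n h _; case: s h => h; invert; (split; [nil | mono]). Qed.

Lemma sound_RI_l_rev s : sound [::] [:: (Cup, 0%N); X s 1; (Cap, 0%N)].
Proof.
move=> [|a t] ts n h // _; invert; split; last by mono.
apply: (reach_cup0 (a := (b, ~~ b0, s0))); apply: reach_dbl1.
by case: s => /=; apply: reach_cap0; [labels | nil | labels | nil].
Qed.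

Lemma sound_RII s : sound [:: X s 0; X (~~ s) 0] [::].
Proof. by move=> t ts n h _; case: s h => h; invert; (split; [nil | mono]). Qed.

Lemma sound_RII_rev s : sound [::] [:: X s 0; X (~~ s) 0].
Proof.
move=> [|a [|a' t]] ts n h // _; invert; split; try by mono.
by apply: reach_dbl0; apply: reach_dbl0; case: s; nil.
Qed.

Lemma sound_RIII s : sound [:: X s 0; X s 1; X s 0] [:: X s 1; X s 0; X s 1].
Proof.
move=> t ts n h _; case: s h => h; invert; (split; last by mono);
by apply: reach_dbl1; apply: reach_dbl0; apply: reach_dbl1; nil.
Qed.

Lemma sound_RIII_rev s : sound [:: X s 1; X s 0; X s 1] [:: X s 0; X s 1; X s 0].
Proof.
move=> t ts n h _; case: s h => h; invert; (split; last by mono);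
by apply: reach_dbl0; apply: reach_dbl1; apply: reach_dbl0; nil.
Qed.

Lemma sound_RIV s :
  sound [:: (Vtx, 0%N); X s 1; X s 0] [:: X s 1; X s 0; (Vtx, 1%N)].
Proof.
move=> t ts n h _; case: s h => h; invert; (split; last by mono);
  apply: reach_dbl1; apply: reach_dbl0; match goal with
  |- reach _ _ [:: _, ?c, ?d & _] _ =>
    apply: (reach_vtx1 (c := c) (d := d)); first by vtx end;
  nil.
Qed.

Lemma sound_RIV_rev s :
  sound [:: X s 1; X s 0; (Vtx, 1%N)] [:: (Vtx, 0%N); X s 1; X s 0].
Proof.
move=> t ts n h _; case: s h => h; invert; (split; last by mono); match goal with
  |- reach _ [:: (_, ?z), _ & _] [:: _, (?c, _), (?d, _) & _] _ =>
    apply: (reach_vtx0 (c := (c, z)) (d := (d, z))); first by vtx end;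
  apply: reach_dbl1; apply: reach_dbl0; nil.
Qed.

(** If the lower strands lie on different petals, the upper ones carry the same two charges, so the
    crossing keeps its sign; if they lie on one petal, neither crossing counts. The common colour at
    the vertex makes the Fox relation trivial. *)
Lemma sound_RV s : sound [:: X s 0; (Vtx, 0%N)] [:: (Vtx, 0%N); X s 0].
Proof.
move=> t ts n h _; case: s h => h; invert; (split; last by mono); match goal with
  |- reach _ [:: (_, ?z), _ & _] [:: (?c, _), (?d, _) & _] _ =>
    apply: (reach_vtx0 (c := (d, z)) (d := (c, z))); first by vtx end;
  apply: reach_dbl0; nil.
Qed.

Lemma sound_RV_rev s : sound [:: (Vtx, 0%N); X s 0] [:: X s 0; (Vtx, 0%N)].
Proof.
move=> t ts n h _; case: s h => h; invert; (split; last by mono);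
  apply: reach_dbl0; match goal with
  |- reach _ _ [:: ?c, ?d & _] _ =>
    apply: (reach_vtx0 (c := c) (d := d)); first by vtx end;
  nil.
Qed.

End Soundness.

(** * Invariance of weights and of monochromaticity *)

Section Invariance.

Local Open Scope ring_scope.

Variable M : comNzRingType.

Notation step := (step (@rev_label M) (@cross_label M) (@sign M) (@vertex_label M)).
Notation trace := (trace (@rev_label M) (@cross_label M) (@sign M) (@vertex_label M)).
Notation reach := (reach (@rev_label M) (@cross_label M) (@sign M) (@vertex_label M)).
Notation sound := (@sound M).

Lemma cat_prefix (T : Type) (s1 s2 t1 t2 : seq T) :
  s1 ++ s2 = t1 ++ t2 -> (size t1 <= size s1)%N ->
  exists2 u, s1 = t1 ++ u & t2 = u ++ s2.
Proof.
elim: t1 s1 => [|a t1 IH] [|b s1] //=; first by move=> <-; exists [::].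
  by move=> <-; exists (b :: s1).
by move=> [-> /IH h] /h[u -> ->]; exists u.
Qed.

Lemma mono_cat x (s t : seq (label M)) : mono x (s ++ t) = mono x s && mono x t.
Proof. exact: all_cat. Qed.

Lemma trace2 a b s ts n : trace [:: a; b] s ts n -> exists t1 t2 n1 n2,
  [/\ ts = [:: t1; t2], step a.1 a.2 s t1 n1, step b.1 b.2 t1 t2 n2 & n = n1 + n2].
Proof.
case: ts => [|t1 [|t2 [|? ?]]] //= [n1 [m [sa]]] //; last by move=> [? [? []]].
by move=> [n2 [n3 [sb -> ->]]] ->; exists t1, t2, n1, n2; rewrite addr0.
Qed.

Lemma sound_far0 k l j :
  sound [:: (k, 0%N); (l, (j + ar_out k)%N)] [:: (l, (j + ar_in k)%N); (k, 0%N)].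
Proof.
move=> s ts n /trace2[t1 [t2 [n1 [n3 [-> + + ->]]]]] _.
move=> /passes_inv[ins [outs [q [-> -> si so kq]]]] /step_inv.
move=> [P [s' [t' [sP + -> lq]]]] => /esym/cat_prefix[|P' eP ->].
  by rewrite sP so leq_addl.
move: sP; rewrite {}eP size_cat so addnC => /addIn sP'; split.
  apply: (@reach_cons _ _ _ _ _ _ _ _ _ ((ins ++ P') ++ t') _ n3).
    by rewrite catA; apply: step_at => //; rewrite size_cat si sP' addnC.
  apply: (@reach_cons _ _ _ _ _ _ _ _ _ ((outs ++ P') ++ t') _ n1).
    by rewrite -!catA; apply: kq.
  by apply: reach_nil => //; lia.
by move=> x /=; rewrite !mono_cat => /and3P[_ p1 p2] /andP[/andP[p3 _] p4];
   rewrite p1 p2 p3 p4.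
Qed.

Lemma sound_far0_rev k l j :
  sound [:: (l, (j + ar_in k)%N); (k, 0%N)] [:: (k, 0%N); (l, (j + ar_out k)%N)].
Proof.
move=> s ts n /trace2[t1 [t2 [n1 [n3 [-> + + ->]]]]] _.
move=> /step_inv[P [s' [t' [sP -> -> lq]]]] /passes_inv.
move=> [ins [outs [q [+ -> si so kq]]]] => /cat_prefix[|P' eP ->].
  by rewrite sP si leq_addl.
move: sP; rewrite {}eP size_cat si addnC => /addIn sP'; split.
  apply: (@reach_cons _ _ _ _ _ _ _ _ _ (outs ++ P' ++ s') _ n3).
    by rewrite -catA; apply: kq.
  apply: (@reach_cons _ _ _ _ _ _ _ _ _ (outs ++ P' ++ t') _ n1).
    by rewrite !catA; apply: step_at => //; rewrite size_cat so sP' addnC.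
  by apply: reach_nil => //; lia.
by move=> x /=; rewrite !mono_cat => /andP[/andP[p1 p2] p3] /and3P[p4 p5 p6];
   rewrite p1 p2 p4 p6.
Qed.

Lemma trace_unshift a w s ts n : trace (shift 1 w) (a :: s) ts n ->
  exists2 ts', ts = map (cons a) ts' & trace w s ts' n.
Proof.
elim: w s ts n => [|[k i] w IH] s [|t ts] n //=; first by exists [::].
move=> [n1 [n2 [st h ->]]]; case: t st h => // b t [<- st] /IH[ts' -> h].
by exists (t :: ts') => //=; exists n1, n2.
Qed.

Lemma width_shift n w : width n.+1 (shift 1 w) = omap succn (width n w).
Proof.
elim: w n => //= -[k i] w IH n; rewrite add1n addSn ltnS.
by case: ifP => // kn; rewrite -IH subSn ?addSn //; lia.
Qed.

(** An additional strand on the left keeps its label throughout; hence each move needs to be checked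
    only in its leftmost position. *)
Lemma sound_shift1 l r : sound l r -> sound (shift 1 l) (shift 1 r).
Proof.
move=> lr [|a s] ts n.
  case: l {lr} => [|[k i] l] /=; last by case: ts => // t ts [? [? []]].
  case: ts => // ->; case: r => [|[k i] r] //= _.
  by split=> //; apply: reach_nil.
move=> /trace_unshift[ts' -> h] /=; rewrite width_shift => w.
have [|h1 h2] := lr s ts' n h; first by case: (width _ r) w.
split=> [|x]; first by rewrite last_map; apply: (@reach_shift _ _ _ _ _ [:: a]).
rewrite last_map all_map /= => /andP[ax xs] /andP[_ xl].
by have /allP xts := h2 x xs xl; apply/allP => t /xts /= ->; rewrite ax.
Qed.

Lemma sound_shift i l r : sound l r -> sound (shift i l) (shift i r).
Proof.
move=> lr; elim: i => [|i IH].
  have s0 w : shift 0 w = w by elim: w => //= -[k j] w {2}<-.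
  by rewrite !s0.
have sS w : shift i.+1 w = shift 1 (shift i w).
  by rewrite /shift -map_comp; apply: eq_map.
by rewrite !sS; apply: sound_shift1.
Qed.

Lemma rule_sound l r : rule l r -> sound l r /\ sound r l.
Proof.
have sh i w1 w2 w3 w4 : sound w1 w2 -> sound w2 w1 ->
    w3 = shift i w1 -> w4 = shift i w2 -> sound w3 w4 /\ sound w4 w3.
  by move=> ? ? -> ->; split; apply: sound_shift.
case=> {l r} [k k' i j ij|i|i|s i|s i|i|i|s i|s i|s i|s i|s i|s i].
- rewrite -(subnKC ij); apply: (sh i _ _ _ _ (@sound_far0 k k' (j - i))
    (@sound_far0_rev k k' (j - i)));
    by rewrite /shift /= addn0 addnA.
- by apply: (sh i _ _ _ _ (@sound_zigzag_l M) (@sound_zigzag_l_rev M));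
    rewrite /shift /= ?addn0 ?addn1.
- by apply: (sh i _ _ _ _ (@sound_zigzag_r M) (@sound_zigzag_r_rev M));
    rewrite /shift /= ?addn0 ?addn1.
- by apply: (sh i _ _ _ _ (@sound_turn_cap M s) (@sound_turn_cap_rev M s));
    rewrite /shift /= ?addn0 ?addn1.
- by apply: (sh i _ _ _ _ (@sound_turn_cup M s) (@sound_turn_cup_rev M s));
    rewrite /shift /= ?addn0 ?addn1.
- by apply: (sh i _ _ _ _ (@sound_vtx_cap M) (@sound_vtx_cap_rev M));
    rewrite /shift /= ?addn0 ?addn1.
- by apply: (sh i _ _ _ _ (@sound_vtx_cup M) (@sound_vtx_cup_rev M));
    rewrite /shift /= ?addn0 ?addn1.
- by apply: (sh i _ _ _ _ (@sound_RI_r M s) (@sound_RI_r_rev M s));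
    rewrite /shift /= ?addn0 ?addn1.
- by apply: (sh i _ _ _ _ (@sound_RI_l M s) (@sound_RI_l_rev M s));
    rewrite /shift /= ?addn0 ?addn1.
- by apply: (sh i _ _ _ _ (@sound_RII M s) (@sound_RII_rev M s));
    rewrite /shift /= ?addn0 ?addn1.
- by apply: (sh i _ _ _ _ (@sound_RIII M s) (@sound_RIII_rev M s));
    rewrite /shift /= ?addn0 ?addn1.
- by apply: (sh i _ _ _ _ (@sound_RIV M s) (@sound_RIV_rev M s));
    rewrite /shift /= ?addn0 ?addn1.
- by apply: (sh i _ _ _ _ (@sound_RV M s) (@sound_RV_rev M s));
    rewrite /shift /= ?addn0 ?addn1.
Qed.

Definition has_weight (D : word) (n : int) : Prop := reach D [::] [::] n.

Definition monochromatic (D : word) : Prop := forall ts n,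
  trace D [::] ts n -> last [::] ts = [::] -> exists x, all (mono x) ts.

Lemma sound_ctx l r u v : sound l r ->
  closed (u ++ l ++ v) -> closed (u ++ r ++ v) ->
  (forall n, has_weight (u ++ l ++ v) n -> has_weight (u ++ r ++ v) n) /\
  (monochromatic (u ++ r ++ v) -> monochromatic (u ++ l ++ v)).
Proof.
move=> lr _ cr.
have wr ts n : trace u [::] ts n -> width (size (last [::] ts)) r <> None.
  move=> /trace_width; move: cr; rewrite /closed !width_cat => + /= e; rewrite e /=.
  by rewrite width_cat; case: (width _ r).
split=> [n [ts]|mr ts n].
  move=> /trace_cat[ts1 [ts' [n1 [n' [-> tu + ->]]]]].
  move=> /trace_cat[ts2 [ts3 [n2 [n3 [-> tl tv ->]]]]].
  rewrite !last_cat => l3; have [r2 _] := lr _ _ _ tl (wr _ _ tu).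
  have u1 : reach u [::] (last [::] ts1) n1 by exists ts1.
  have v1 : reach v (last (last [::] ts1) ts2) [::] n3 by exists ts3.
  exact: (reach_cat u1 (reach_cat r2 v1)).
move=> /trace_cat[ts1 [ts' [n1 [n' [-> tu + _]]]]].
move=> /trace_cat[ts2 [ts3 [n2 [n3 [-> tl tv _]]]]].
rewrite !last_cat => l3; have [[ts2' h2' e2'] m2] := lr _ _ _ tl (wr _ _ tu).
have [||x] := mr (ts1 ++ ts2' ++ ts3) (n1 + (n2 + n3)).
- apply/trace_cat; exists ts1, (ts2' ++ ts3), n1, (n2 + n3); split=> //.
  by apply/trace_cat; exists ts2', ts3, n2, n3; rewrite e2'.
- by rewrite !last_cat e2'.
(* The labels just below and just above [l] also bound [r], so they have the colour [x], and
   soundness spreads it to the inside of [l]. *)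
rewrite !all_cat => /and3P[m1 m2' m3]; exists x; rewrite !all_cat m1 m3 andbT /=.
have ml t rs : mono x t -> all (mono x) rs -> mono x (last t rs).
  by elim: rs t => //= t' rs IH t _ /andP[mt']; apply: IH.
have m0 : mono x (last [::] ts1) by apply: ml.
by apply: (m2 x m0); rewrite -e2'; apply: ml.
Qed.

Lemma equivalent_invariants D E : equivalent D E ->
  (forall n, has_weight D n <-> has_weight E n) /\
  (monochromatic D <-> monochromatic E).
Proof.
elim=> {D E} [D E|D|D E _ [w m]|D E F _ [w1 m1] _ [w2 m2]].
- move=> [cD cE [u [v [l [r [lr eD eE]]]]]]; subst D E.
  have [s1 s2] := rule_sound lr.
  have [a1 b1] := sound_ctx s1 cD cE; have [a2 b2] := sound_ctx s2 cE cD.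
  by split=> [n|]; split; auto.
- by [].
- by split=> [n|]; split; apply w || apply m.
- split=> [n|]; first by apply: (iff_trans (w1 n)).
  exact: (iff_trans m1).
Qed.

Lemma trivialK_weight n : has_weight trivialK n -> n = 0.
Proof. by case=> ts /trivialK_trace[]. Qed.

Lemma trivialK_monochromatic : monochromatic trivialK.
Proof. by move=> ts n /trivialK_trace[]. Qed.

Lemma trivialL_weight n : has_weight trivialL n -> n = 1 \/ n = -1.
Proof. by case=> ts /trivialL_trace. Qed.

End Invariance.

(** * Connectedness and the parity of the stacks *)

Section Components.

Definition straight (o : option bool) (a b : bool) : bool * bool := (b, a).

Notation all_equal := (fun a b c d : bool => [&& a == b, b == c & c == d]).
Notation trace := (trace id straight (fun _ _ _ => 0%R) all_equal).
Notation step := (step id straight (fun _ _ _ => 0%R) all_equal).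

(** A labelling that starts and ends with no strands certifies that every letter fits; a constant
    one always exists. *)
Lemma closed_row cs : closed (row cs).
Proof.
have lab : row_labeling id straight all_equal (fun=> true) (fun=> true) cs.
  by split=> // i _; elim: (nth _ _ _).
have [ts [tr l _]] := trace_row (fun _ _ _ => 0%R) (fun x : bool => erefl) lab.
by have := trace_width tr; rewrite l.
Qed.

(** [ts] starts above the first letter, so the empty list is put in front for height 0. *)
Definition label_at (ts : seq (seq bool)) (a : nat * nat) : bool :=
  nth false (nth [::] ([::] :: ts) a.1) a.2.

Lemma trace_split w ts n u k i v : trace w [::] ts n -> w = u ++ (k, i) :: v ->
  exists s t m, [/\ nth [::] ([::] :: ts) (size u) = s,
    nth [::] ([::] :: ts) (size u).+1 = t & step k i s t m].
Proof.
move=> + ew; rewrite {}ew => /trace_cat[ts1 [ts2 [n1 [n2 [-> tu + _]]]]].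
have su : size u = size ts1 by elim: u [::] ts1 n1 tu => [|a u IH] s [|t ts1] //= m [? [? [_ /IH->]]].
case: ts2 => // t ts2 [m [? [st _ _]]]; exists (last [::] ts1), t, m; split=> //.
  by rewrite -cat_cons nth_cat /= su ltnSn nth_last.
by rewrite /= nth_cat su ltnn subnn.
Qed.

Lemma link_label w ts n a b : trace w [::] ts n -> link w a b ->
  label_at ts a = label_at ts b.
Proof.
move=> tw; rewrite /label_at.
have nthP (P s : seq bool) p : nth false (P ++ s) (size P + p) = nth false s p.
  by rewrite nth_cat ltnNge leq_addr addKn.
have nthP0 (P s : seq bool) : nth false (P ++ s) (size P) = nth false s 0.
  by rewrite -[size P]addn0 nthP.
have nthP1 (P s : seq bool) : nth false (P ++ s) (size P).+1 = nth false s 1.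
  by rewrite -addn1 nthP.
case=> [u v k i p|u v k i p|u v i|u v i|u v c i|u v c i|u v i|u v i|u v i] /(trace_split tw)
  [s [t [m [/= es et /step_inv[P [s' [t' [<- eqs eqt st]]]]]]]];
  rewrite ?es ?et ?eqs ?eqt {es et eqs eqt s t}.
- by rewrite !nth_cat => ->.
- have [ins [outs [q [-> -> <- <- _]]]] := passes_inv st.
  by rewrite -!addnA !nthP.
- by case: st => x -> _; rewrite nthP0 nthP1.
- by case: st => x -> _; rewrite nthP0 nthP1.
- by case: st => x [y [q [-> -> _]]]; rewrite nthP0 nthP1.
- by case: st => x [y [q [-> -> _]]]; rewrite nthP0 nthP1.
- by case: st => x [y [c [d [q [-> _ /and3P[/eqP] + _ _ _]]]]]; rewrite nthP0 nthP1.
- by case: st => x [y [c [d [q [_ -> /and3P[_ _ /eqP] + _]]]]]; rewrite nthP0 nthP1.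
- by case: st => x [y [c [d [q [-> -> /and3P[/eqP -> /eqP + _] _]]]]]; rewrite !nthP0.
Qed.

Lemma connected_label w ts n : trace w [::] ts n ->
  (forall a b, is_point w a -> is_point w b -> clos_refl_sym_trans _ (link w) a b) ->
  forall s, s \in ts -> {in s &, forall x y, x = y}.
Proof.
move=> tw conn s /(nthP [::])[t ts_t es] x y /(nthP false)[p ps ex] /(nthP false)[q qs ey].
have pt r : r < size s -> is_point w (t.+1, r).
  move=> rs; have sw : size w = size ts.
    by elim: w [::] ts n tw {conn ts_t es} => [|a w IH] s0 [|t0 ts] //= m [? [? [_ /IH->]]].
  split; first by rewrite sw.
  exists (size s) => //; move: tw; rewrite -[w in trace w](cat_take_drop t.+1).
  move=> /trace_cat[ts1 [ts2 [n1 [n2 [ets tu _ _]]]]]; rewrite (trace_width tu); congr Some.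
  have s1 : size ts1 = t.+1.
    have <- : size (take t.+1 w) = t.+1 by rewrite size_takel ?sw.
    by elim: (take _ _) [::] ts1 n1 tu {ets} => [|a u IH] s0 [|t0 ts1] //= m [? [? [_ /IH->]]].
  by rewrite -es ets nth_cat s1 ltnSn (last_nth [::]) s1.
have {conn pt} := conn _ _ (pt p ps) (pt q qs).
suff lab a b : clos_refl_sym_trans _ (link w) a b -> label_at ts a = label_at ts b.
  by move/lab; rewrite /label_at /= es ex ey.
elim=> [{}a {}b|//|{}a {}b _ ->|{}a {}b c _ -> _ ->] //; exact: (link_label tw).
Qed.

(* Two even stacks would cut off the component formed by the arcs between them. *)
Lemma bouquet_even cs i j : two_bouquet (row cs) ->
  i < size cs -> j < size cs -> i != j ->
  odd (size (nth [::] cs i)) || odd (size (nth [::] cs j)).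
Proof.
move=> [_ _ conn] ik jk ij; apply/norP => -[ei ej].
pose g t := (i < t) (+) (j < t).
have th c a b : thread straight c a b = if odd (size c) then (b, a) else (a, b).
  by elim: c a b => //= o c IH a b; rewrite IH; case: odd.
have lab : row_labeling id straight all_equal g g cs.
  split=> [|t tk]; first by rewrite /g /= !ltn0 ik jk.
  rewrite th; case: ifP => // ot.
  have ti : t != i by apply: contraTneq ot => ->.
  have tj : t != j by apply: contraTneq ot => ->.
  suff -> : g t.+1 = g t by [].
  by rewrite /g !ltnS [i <= t]leq_eqVlt [j <= t]leq_eqVlt ![_ == t]eq_sym (negbTE ti) (negbTE tj).
have [ts [tr _ bts]] := trace_row (fun _ _ _ => 0%R) (fun x : bool => erefl) lab.
have gk : g (size cs) \in bottom id g (size cs) by rewrite mem_head.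
(* Gap [maxn i j] is just left of the later of the two stacks, hence between them, whereas gap
   [size cs] ends at the vertex. *)
have gm : g (maxn i j) \in bottom id g (size cs) by rewrite mem_bottom // gtn_max ik.
by have := connected_label tr conn bts gk gm; rewrite /g ik jk; lia.
Qed.

End Components.

(** * Lower bounds *)

Section LowerBound.

Local Open Scope ring_scope.

Definition negatives (c : seq (option bool)) : nat := count_mem (Some false) c.

(** In this form the parity of the net number is visibly that of the height of the stack, which is
    what rules out type L when a stack is even. *)
Definition net (c : seq (option bool)) : int := (size c)%:Z - (negatives c).*2%:Z.

Lemma net_cons s c : net (Some s :: c) = sgn s + net c.
Proof. by rewrite /net /negatives /=; case: s => /=; lia. Qed.

(** Each crossing shifts both colours by the same amount, plus or minus their difference, and so
    preserves the difference; the shifts add up to a multiple of it by [net c]. *)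
Lemma thread_label (M : comNzRingType) c (a b : label M) : None \notin c ->
  thread (@cross_label M) c a b =
  let d := (b.2 - a.2) *~ net c in
  if odd (size c) then ((b.1, a.2 - d), (a.1, b.2 - d))
  else ((a.1, a.2 - d), (b.1, b.2 - d)).
Proof.
elim: c a b => [|[s|] c IH] a b //=.
  by move=> _; rewrite /net /negatives /= subrr mulr0z !subr0; case: a b => [? ?] [? ?].
rewrite inE /= => /IH->; rewrite net_cons; set e := net c.
have [-> ->] : (cross_label (Some s) a b).1 = (b.1, a.2 - (b.2 - a.2) *~ sgn s) /\
    (cross_label (Some s) a b).2 = (a.1, b.2 - (b.2 - a.2) *~ sgn s).
  case: a b s => [p x] [q y] [] /=; rewrite ?mulrNz mulr1z; split; congr (_, _); ring.
set d := (b.2 - a.2) *~ sgn s => /=.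
have -> : b.2 - d - (a.2 - d) = b.2 - a.2 by ring.
rewrite mulrzDr -/d !opprD !addrA.
by case: (odd (size c)).
Qed.

Lemma thread_weight_label (M : comNzRingType) c (a b : label M) : None \notin c ->
  thread_weight (@cross_label M) (@sign M) c a b =
  if a.1.1 == b.1.1 then 0 else sgn (~~ (a.1.2 (+) b.1.2)) * net c.
Proof.
elim: c a b => [|[s|] c IH] a b //=.
  by move=> _; rewrite /net /negatives /= subrr mulr0; case: ifP.
rewrite inE /= => /IH->; rewrite net_cons.
case: a b s => [[p d] x] [[q e] y] [] /=; rewrite ?[q == p]eq_sym; case: ifP => // _;
  case: d; case: e; rewrite /sgn /=; ring.
Qed.

(** Successive gaps alternate between the petals; lower arcs go up at their left ends and upper arcs
    go down. In every stack the strands then belong to different petals and are antiparallel, whence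
    the minus sign. *)
Lemma odd_row_weight (M : comNzRingType) cs :
  (forall i, (i < size cs)%N -> odd (size (nth [::] cs i)) && (None \notin nth [::] cs i)) ->
  has_weight M (row cs) (- \sum_(i < size cs) net (nth [::] cs i)).
Proof.
move=> ocs; pose g i : label M := ((odd i, true), 0).
pose h i : label M := ((~~ odd i, false), 0).
have lab : row_labeling (@rev_label M) (@cross_label M) (@vertex_label M) g h cs.
  split=> [|i ik]; first by rewrite /vertex_label /= !eqxx andbT /opp /=; case: odd.
  have /andP[oi ni] := ocs i ik.
  rewrite thread_label // oi /= subrr mul0rz subr0 /h /rev_label /opp /=.
  by case: odd.
have [ts [tr l _]] := trace_row (@sign M) (@rev_labelK M) lab.
suff -> : - \sum_(i < size cs) net (nth [::] cs i) =
    row_weight (@rev_label M) (@cross_label M) (@sign M) g cs by exists ts.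
rewrite /row_weight -sumrN; apply: eq_bigr => i _; have /andP[oi ni] := ocs i (ltn_ord i).
by rewrite thread_weight_label //= ; case: odd => /=; rewrite mulN1r.
Qed.

(* The arcs change petal at stack j only; their directions alternate. *)
Lemma even_row_labeling (M : comNzRingType) cs j (g : nat -> M) :
  let p i : label M := (((j < i)%N, odd i), g i) in
  (j < size cs)%N ->
  (forall i, (i < size cs)%N ->
     (odd (size (nth [::] cs i)) == (i != j)) && (None \notin nth [::] cs i)) ->
  g (size cs) = g 0%N ->
  (forall i, (i < size cs)%N -> (g i.+1 - g i) *~ net (nth [::] cs i) = 0) ->
  row_labeling (@rev_label M) (@cross_label M) (@vertex_label M) p p cs.
Proof.
move=> p jk ocs g0 gn; split=> [|i ik].
  by rewrite /vertex_label /= g0 jk !eqxx andbT /opp /=; case: odd.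
have /andP[/eqP oi ni] := ocs i ik.
rewrite thread_label // oi /= (gn i ik) !subr0 /p /rev_label /opp /= ltnS [(j <= i)%N]leq_eqVlt.
by case: eqVneq => [->|ij] /=; rewrite ?ltnn ?negbK.
Qed.

Lemma even_row_weight (M : comNzRingType) cs j :
  (j < size cs)%N ->
  (forall i, (i < size cs)%N ->
     (odd (size (nth [::] cs i)) == (i != j)) && (None \notin nth [::] cs i)) ->
  has_weight M (row cs) (net (nth [::] cs j)).
Proof.
move=> jk ocs.
have c0 i : (i < size cs)%N -> (0 - 0 : M) *~ net (nth [::] cs i) = 0.
  by move=> _; rewrite subrr mul0rz.
have lab := @even_row_labeling M cs j (fun=> 0) jk ocs erefl c0.
have [ts [tr l _]] := trace_row (@sign M) (@rev_labelK M) lab.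
pose p i : label M := (((j < i)%N, odd i), 0).
suff -> : net (nth [::] cs j) =
    row_weight (@rev_label M) (@cross_label M) (@sign M) p cs by exists ts.
rewrite /row_weight (bigD1 (Ordinal jk)) //= big1 ?addr0 => [|i /eqP ij].
  have /andP[_ nj] := ocs j jk.
  by rewrite thread_weight_label //= ltnn ltnS leqnn /= addbb mul1r.
have /andP[_ ni] := ocs i (ltn_ord i).
have ji : (j == i) = false by apply/eqP => ji; case: ij; apply: val_inj.
by rewrite thread_weight_label //= ltnS [(j <= i)%N]leq_eqVlt ji eqxx.
Qed.

(** A colour difference across a stack is compatible with it when its product with the net number
    vanishes, so the colour may jump at the stacks [i] and [j]. *)
Lemma even_row_monochromatic (M : comNzRingType) cs j i :
  (j < size cs)%N -> (i < size cs)%N -> i != j ->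
  (forall i, (i < size cs)%N ->
     (odd (size (nth [::] cs i)) == (i != j)) && (None \notin nth [::] cs i)) ->
  net (nth [::] cs j) = 0 -> (net (nth [::] cs i))%:~R = 0 :> M ->
  ~ monochromatic M (row cs).
Proof.
move=> jk ik ij ocs nj ni; pose g t : M := ((i < t) (+) (j < t))%N%:R.
have [||ts [tr l bts]] := trace_row (@sign M) (@rev_labelK M) (@even_row_labeling M cs j g jk ocs _ _).
- by rewrite /g ik jk !ltn0.
- move=> t tk; rewrite /g !ltnS.
  have [->|ti] := eqVneq t i.
    by rewrite -mulrzr ni mulr0.
  have [->|tj] := eqVneq t j; first by rewrite nj mulr0z.
  have -> : (i <= t)%N = (i < t)%N by rewrite leq_eqVlt eq_sym (negbTE ti).
  have -> : (j <= t)%N = (j < t)%N by rewrite leq_eqVlt eq_sym (negbTE tj).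
  by rewrite subrr mul0rz.
move=> /(_ ts _ tr l)[x /allP/(_ _ bts)/allP mx].
set p := fun i0 => _ in bts mx.
have /eqP /= x0 := mx _ (mem_head _ _).
have mk : (maxn i j < size cs)%N by rewrite gtn_max ik.
have /eqP /= x1 := mx _ (mem_bottom _ p mk).
have : 1 = 0 :> M.
  transitivity (g (maxn i j)); first by rewrite /g (_ : _ (+) _ = true) //; lia.
  by rewrite x1 -x0 /g ik jk.
by apply/eqP; rewrite oner_eq0.
Qed.

(** The lower bounds need only the two resolutions that complete all stacks by one and the same
    type: they realize the extreme values of [net]. *)
Definition fill (b : bool) (c : seq (option bool)) : seq (option bool) :=
  [seq Some (odflt b o) | o <- c].

Lemma fillP b c : None \notin fill b c.
Proof. by apply/mapP => -[]. Qed.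

Lemma net_fill b (c : seq (option bool)) :
  net (fill b c) = net (fill true c) - ((~~ b) * (undecided c).*2)%N%:Z.
Proof.
have e : negatives (fill false c) = (negatives (fill true c) + undecided c)%N.
  by elim: c => // -[[]|] c /=; rewrite /negatives /undecided /= => ->; lia.
by case: b; rewrite /net !size_map ?e /=; lia.
Qed.

Lemma resolution_fill b cs : resolution (row cs) (row (map (fill b) cs)).
Proof.
split.
  apply: row_replaced; elim: cs => //= c cs ->; rewrite andbT.
  by elim: c => //= -[o|] c -> //=; rewrite /resolves eqxx.
rewrite npre_row -map_comp; elim: cs => //= c cs ->; rewrite addn0.
exact/count_memPn/fillP.
Qed.

Lemma nth_fill b cs i : nth [::] (map (fill b) cs) i = fill b (nth [::] cs i).
Proof. by elim: cs i => [|c cs IH] [|i] /=. Qed.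

Lemma K_trivial_weight cs b n : K_trivial (row cs) ->
  has_weight int (row (map (fill b) cs)) n -> n = 0.
Proof.
move=> K fw; have [w _] := equivalent_invariants int (K _ (resolution_fill b cs)).
exact/(trivialK_weight (M := int))/w/fw.
Qed.

Lemma L_trivial_weight cs b n : L_trivial (row cs) ->
  has_weight int (row (map (fill b) cs)) n -> n = 1 \/ n = -1.
Proof.
move=> K fw; have [w _] := equivalent_invariants int (K _ (resolution_fill b cs)).
exact/(trivialL_weight (M := int))/w/fw.
Qed.

End LowerBound.

(** * Trivializing numbers *)

Lemma tr_eq Q v : trivializable Q v -> (forall d, trivializable Q d -> v <= d) ->
  tr Q = Some v.
Proof.
move=> tv min; rewrite /tr; case: pselect => [ex|[]]; last by exists v; apply/asboolP.
congr Some; case: ex_minnP => d /asboolP td mind.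
by apply/eqP; rewrite eqn_leq min // mind //; apply/asboolP.
Qed.

Lemma resolves_nseq x c : all2 resolves (nseq x None) c = (size c == x).
Proof. by elim: x c => [|x IH] [|o c] //=; rewrite IH. Qed.

(** What replaces precrossings in a row is again a row, so the question becomes one about lists of
    stacks. *)
Lemma trivializable_pretzelP xs d : trivializable (pretzel_row xs) d <->
  exists cs : seq (seq (option bool)), [/\ map size cs = xs, sumn xs = sumn (map undecided cs) + d
               & K_trivial (row cs) \/ L_trivial (row cs)].
Proof.
have npre_xs : npre (pretzel_row xs) = sumn xs.
  rewrite pretzel_rowE npre_row -map_comp; congr sumn; rewrite -[RHS]map_id.
  by apply: eq_map => x /=; rewrite /undecided count_nseq /= mul1n.
rewrite /trivializable npre_xs pretzel_rowE; split=> [[Q' [/replaced_row[cs -> cxs]]]|[cs [sxs ex KL]]].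
  rewrite npre_row => ex KL; exists cs; split=> //.
  elim: xs cs cxs {npre_xs ex KL} => [|x xs IH] [|c cs] //= /andP[].
  by rewrite resolves_nseq => /eqP-> /IH->.
exists (row cs); split; rewrite ?npre_row //; apply: row_replaced.
rewrite -sxs; elim: cs {sxs ex KL} => //= c cs ->.
by rewrite resolves_nseq eqxx.
Qed.

Lemma odd_sumn xs : all odd xs -> odd (sumn xs) = odd (size xs).
Proof. by elim: xs => //= x xs IH /andP[ox /IH]; rewrite oddD ox => ->. Qed.

(** One [p], the number of negative crossings already chosen, serves both fillings, so they differ
    by exactly twice the number of undecided entries. *)
Lemma sum_net_fill (cs : seq (seq (option bool))) : exists p, forall b,
  (\sum_(c <- map (fill b) cs) net c = (sumn (map size cs))%:Z -
     (p + ~~ b * sumn (map undecided cs)).*2%:Z)%R.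
Proof.
elim: cs => [|c cs [p IH]] /=; first by exists 0 => b; rewrite big_nil muln0.
exists (negatives (fill true c) + p) => b; rewrite big_cons IH net_fill /net size_map.
by case: b => /=; rewrite ?mul0n ?mul1n; lia.
Qed.

Lemma odd_row_weight_fill cs b : all odd (map size cs) ->
  has_weight int (row (map (fill b) cs)) (- \sum_(c <- map (fill b) cs) net c)%R.
Proof.
move=> ocs; rewrite (big_nth [::]) big_mkord; apply: odd_row_weight => i.
rewrite size_map => ik; rewrite nth_fill fillP andbT size_map.
by rewrite -(nth_map [::] 0) //; apply: all_nthP; rewrite ?size_map.
Qed.

Lemma tr_odd_lower xs d : all odd xs -> trivializable (pretzel_row xs) d ->
  (if odd (size xs) then (sumn xs).-1 else sumn xs) <= d.
Proof.
move=> oxs /trivializable_pretzelP[cs [sxs ex KL]].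
have oddxs := odd_sumn oxs; rewrite -{1}sxs in oxs.
have fw b := odd_row_weight_fill b oxs.
have [p sp] := sum_net_fill cs; rewrite sxs in sp.
case: KL => [K | L].
  (* Both fillings have weight 0, so no precrossing is left. *)
  have := K_trivial_weight K (fw true); have := K_trivial_weight K (fw false).
  by rewrite !sp /= mul0n mul1n; case: odd; lia.
(* Both weights are 1 or -1, so at most one precrossing is left; moreover they have the parity of
   [size xs], which must be odd. *)
have := L_trivial_weight L (fw true); have := L_trivial_weight L (fw false).
by rewrite !sp -oddxs /= mul0n mul1n; case: ifP; lia.
Qed.

(** ['Z_N] is the ring of integers modulo [N] only for [N] at least 2, whence the hypothesis. *)
Lemma intr_Zp (N : nat) (z : int) : 1 < N -> `|z|%N = N -> (z%:~R = 0 :> 'Z_N)%R.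
Proof.
move=> N1 zN; have [->|->] : z = Posz N \/ z = (- Posz N)%R by lia.
  exact: pchar_Zp.
by rewrite mulrNz; apply/eqP; rewrite oppr_eq0; apply/eqP; apply: pchar_Zp.
Qed.

Lemma tr_even_lower xs j d : j < size xs ->
  (forall i, i < size xs -> odd (nth 0 xs i) = (i != j)) ->
  trivializable (pretzel_row xs) d ->
  nth 0 xs j + \sum_(0 <= i < size xs | i != j) (nth 0 xs i - 1) <= d.
Proof.
move=> jk oxs /trivializable_pretzelP[cs [sxs ex KL]].
have sk : size cs = size xs by rewrite -sxs size_map.
have nth_size i : i < size cs -> size (nth [::] cs i) = nth 0 xs i.
  by move=> ik; rewrite -sxs (nth_map [::]).
have ocs b i : i < size (map (fill b) cs) ->
    (odd (size (nth [::] (map (fill b) cs) i)) == (i != j))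
    && (None \notin nth [::] (map (fill b) cs) i).
  rewrite size_map nth_fill fillP size_map andbT => ik.
  by rewrite nth_size // oxs ?eqxx -?sk.
have jk' b : j < size (map (fill b) cs) by rewrite size_map sk.
have fw b := even_row_weight int (jk' b) (ocs b).
have sj : ~~ odd (size (nth [::] cs j)) by rewrite nth_size ?sk // oxs // eqxx.
case: KL => [K | L]; last first.
  (* The weight is the net number of an even stack, so it is even and type L is impossible. *)
  by have := L_trivial_weight L (fw true); rewrite nth_fill /net size_map; lia.
have net0 b := K_trivial_weight K (fw b).
have Nj : undecided (nth [::] cs j) = 0.
  have := net0 false; have := net0 true; rewrite !nth_fill => e.
  by rewrite net_fill e /=; lia.
have Ni i : i < size cs -> i != j -> undecided (nth [::] cs i) <= 1.
  move=> ik ij; rewrite leqNgt; apply/negP => Ni.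
  (* The two fillings have net numbers at least 4 apart, so they cannot both lie between -1 and
     1. *)
  have [b] : exists b, 1 < `|net (fill b (nth [::] cs i))|%N.
    have := net_fill false (nth [::] cs i) => /= e.
    by have [|] := ltnP 1 `|net (fill true (nth [::] cs i))|%N; [exists true | exists false; lia].
  set N := `|_|%N => N1; have ik' : i < size (map (fill b) cs) by rewrite size_map.
  have [_ [_ mK]] := equivalent_invariants 'Z_N (K _ (resolution_fill b cs)).
  apply: (even_row_monochromatic (M := 'Z_N) (jk' b) ik' ij (ocs b) (net0 b)).
    by apply: intr_Zp; rewrite // nth_fill.
  exact/mK/trivialK_monochromatic.
move: ex; rewrite !sumnE big_map (big_nth 0) (bigD1_seq j) ?iota_uniq ?mem_index_iota //=.
rewrite [X in _ = X + d](big_nth [::]) (bigD1_seq j) ?iota_uniq ?mem_index_iota ?sk //= Nj add0n => ex.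
rewrite -(leq_add2l (\sum_(0 <= i < size xs | i != j) undecided (nth [::] cs i))) -ex.
rewrite addnCA leq_add2l -big_split /= big_nat_cond [leqRHS]big_nat_cond.
apply: leq_sum => i /andP[/andP[_ ik] ij].
(* The height is odd, hence positive, so the truncated subtraction of 1 is exact. *)
have := Ni i; rewrite sk => /(_ ik ij); have := oxs i ik; rewrite ij.
by case: (nth 0 xs i) => //= x _; lia.
Qed.

(** * Resolutions attaining the bounds *)

Lemma all2_nth (cs ds : seq (seq (option bool))) : all2 (all2 resolves) cs ds ->
  size ds = size cs /\ forall i, all2 resolves (nth [::] cs i) (nth [::] ds i).
Proof.
elim: cs ds => [|c cs IH] [|d ds] //=; first by split=> // i; rewrite nth_nil.
by move=> /andP[cd /IH[-> h]]; split=> // -[|i] /=; [exact: cd | exact: h].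
Qed.

Lemma resolves_decided c d : undecided c = 0 -> all2 resolves c d -> d = c.
Proof.
rewrite /undecided; elim: c d => [|[b|] c IH] [|o d] //= nc /andP[/eqP<- /IH->] //.
Qed.

Lemma resolution_row cs D : resolution (row cs) D ->
  exists ds, [/\ D = row ds, size ds = size cs
    & forall i, all2 resolves (nth [::] cs i) (nth [::] ds i) && (undecided (nth [::] ds i) == 0)].
Proof.
move=> [/replaced_row[ds -> /all2_nth[sds cds]]]; rewrite npre_row => d0.
exists ds; split=> // i; rewrite cds /=.
elim: ds d0 i {sds cds} => [|d ds IH] /= d0 i; first by rewrite nth_nil.
by case: i => [|i] /=; [|apply: IH]; lia.
Qed.

(** Neighbouring stacks start with opposite crossings, so the single crossings to which odd stacks
    reduce alternate along the row and cancel in pairs. *)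
Fixpoint alternating_stacks (b : bool) (xs : seq nat) : seq (seq (option bool)) :=
  if xs is x :: xs' then alternating b x :: alternating_stacks (~~ b) xs' else [::].

Lemma size_alternating_stacks b xs : map size (alternating_stacks b xs) = xs.
Proof. by elim: xs b => //= x xs IH b; rewrite IH size_alternating. Qed.

Lemma undecided_alternating_stacks b xs :
  sumn (map undecided (alternating_stacks b xs)) = 0.
Proof. by elim: xs b => //= x xs IH b; rewrite IH undecided_alternating. Qed.

Lemma alternating_stacks_decided b xs i :
  undecided (nth [::] (alternating_stacks b xs) i) = 0.
Proof.
by elim: xs b i => [|x xs IH] b [|i] //=; rewrite ?undecided_alternating.
Qed.

Lemma reduces_alternating_stacks p b xs i : all odd xs -> i < size xs ->
  reduces (col p (nth [::] (alternating_stacks b xs) i))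
          (col p (nth [::] (alternating_row b (size xs)) i)).
Proof.
elim: xs b i => // x xs IH b [|i] /= /andP[ox oxs] ik; last exact: IH.
exact: reduces_alternating_odd.
Qed.

Lemma size_alternating_row b n : size (alternating_row b n) = n.
Proof. by elim: n b => //= n IH b; rewrite IH. Qed.

Lemma K_trivial_even xs : all odd xs -> ~~ odd (size xs) ->
  K_trivial (row (alternating_stacks false xs)).
Proof.
move=> oxs ek D /resolution_row[ds [-> sds rds]].
have -> : ds = alternating_stacks false xs.
  apply: (eq_from_nth (x0 := [::])) => // i _; have /andP[r _] := rds i.
  exact: (resolves_decided (alternating_stacks_decided _ _ _) r).
have sa : size (alternating_stacks false xs) = size xs.
  by rewrite -[RHS](congr1 size (size_alternating_stacks false xs)) size_map.
have r1 : reduces (row (alternating_stacks false xs)) (row (alternating_row false (size xs))).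
  apply: reduces_row; first by rewrite size_alternating_row.
  by rewrite sa => p i ik; apply: reduces_alternating_stacks.
apply: (reduces_equivalent (reduces_trans r1 _) (closed_row _)).
rewrite -[size xs]odd_double_half (negbTE ek) add0n.
(* [row [::]] is [trivialK] by computation. *)
exact: (@reduces_alternating_row [::] false).
Qed.

Lemma row_single_trivialL b : equivalent (row [:: single b]) trivialL.
Proof. by case: b; [apply: rst_refl | apply: row_single_equivalent]. Qed.

(** The decided part of the first stack has even height and cancels, and the other stacks cancel in
    pairs. The one crossing that remains may be of either type: both give type L. *)
Lemma L_trivial_odd x xs : odd x -> all odd xs -> ~~ odd (size xs) ->
  L_trivial (row ((None :: alternating true x.-1) :: alternating_stacks false xs)).
Proof.
move=> ox oxs ek D /resolution_row[[|d ds] [-> //= [sds] rds]].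
have [b ->] : exists b, d = Some b :: alternating true x.-1.
  have := rds 0; case: (d) => [|[b|] d'] //=; last by rewrite andbF.
  by move=> /andP[/(resolves_decided (undecided_alternating _ _)) -> _]; exists b.
have -> : ds = alternating_stacks false xs.
  apply: (eq_from_nth (x0 := [::])) => // i _; have /andP[r _] := rds i.+1.
  exact: (resolves_decided (alternating_stacks_decided _ _ _) r).
have sa : size (alternating_stacks false xs) = size xs.
  by rewrite -[RHS](congr1 size (size_alternating_stacks false xs)) size_map.
have r1 : reduces (row ((Some b :: alternating true x.-1) :: alternating_stacks false xs))
    (row ([:: single b] ++ alternating_row false (size xs))).
  apply: reduces_row => /= [|p [|i] /=]; first by rewrite size_alternating_row sa.
    move=> _; apply/reduces_cons/reduces_alternating_even.
    by rewrite -[~~ _]/(odd _.+1) prednK ?odd_gt0.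
  by rewrite sa ltnS => ik; apply: reduces_alternating_stacks.
apply: (rst_trans _ _ _ _ _ _ (row_single_trivialL b)).
apply: (reduces_equivalent (reduces_trans r1 _) (closed_row _)).
rewrite -[size xs]odd_double_half (negbTE ek) add0n.
exact: reduces_alternating_row.
Qed.

Lemma tr_odd xs : 0 < size xs -> all odd xs ->
  tr (pretzel_row xs) = Some (if odd (size xs) then (sumn xs).-1 else sumn xs).
Proof.
move=> xs0 oxs; apply: tr_eq => [|d]; last exact: tr_odd_lower.
apply/trivializable_pretzelP; case: ifP => ok; last first.
  exists (alternating_stacks false xs).
  rewrite size_alternating_stacks undecided_alternating_stacks add0n; split=> //.
  by left; apply: K_trivial_even; rewrite ?ok.
case: xs xs0 oxs ok => // x xs _ /= /andP[ox oxs] ok.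
exists ((None :: alternating true x.-1) :: alternating_stacks false xs); split.
- by rewrite /= size_alternating size_alternating_stacks prednK // odd_gt0.
- have -> : sumn (map undecided ((None :: alternating true x.-1) :: alternating_stacks false xs)) = 1.
    have c1 : undecided (None :: alternating true x.-1) = 1.
      by rewrite /undecided /= -/(undecided _) undecided_alternating.
    by rewrite map_cons -cat1s sumn_cat undecided_alternating_stacks c1.
  by rewrite add1n prednK //= addn_gt0 odd_gt0.
- by right; apply: L_trivial_odd.
Qed.

(** Stack [j] is decided completely because its crossings carry the weight; every other stack keeps
    one precrossing, followed by an even number of crossings that cancel. *)
Definition even_stacks (xs : seq nat) (j : nat) : seq (seq (option bool)) :=
  mkseq (fun i => if i == j then alternating true (nth 0 xs i)
                  else None :: alternating true (nth 0 xs i).-1) (size xs).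

Lemma K_trivial_even_stack xs j : j < size xs ->
  (forall i, i < size xs -> odd (nth 0 xs i) = (i != j)) ->
  K_trivial (row (even_stacks xs j)).
Proof.
move=> jk oxs D /resolution_row[ds [-> sds rds]]; rewrite size_mkseq in sds.
(* For [i] other than [j], [b i] is the crossing that the resolution puts at the one precrossing of
   stack [i]. *)
pose b i := odflt true (head None (nth [::] ds i)).
have r1 : reduces (row ds) (row (mkseq (fun i => if i == j then [::] else single (b i)) (size xs))).
  apply: reduces_row; rewrite ?size_mkseq // sds => p i ik; rewrite nth_mkseq //.
  have := rds i; rewrite nth_mkseq //; case: eqVneq => [-> | ij].
    move=> /andP[/(resolves_decided (undecided_alternating _ _)) -> _].
    by apply: reduces_alternating_even; rewrite oxs // eqxx.
  rewrite /b; case: (nth _ ds i) => [|[b'|] d] //=; last by rewrite andbF.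
  move=> /andP[/(resolves_decided (undecided_alternating _ _)) -> _].
  apply/reduces_cons/reduces_alternating_even; have := oxs i ik; rewrite ij.
  by case: (nth 0 xs i).
have e : mkseq (fun i => if i == j then [::] else single (b i)) (size xs) =
    map single (mkseq b j) ++ [::] :: map single (mkseq (fun i => b (j.+1 + i)) (size xs - j.+1)).
  rewrite -[size xs in LHS](subnKC jk) /mkseq iotaD map_cat -addn1 iotaD map_cat -catA /= add0n eqxx.
  congr (_ ++ _ :: _); rewrite -map_comp.
    by apply/eq_in_map => i; rewrite mem_iota add0n => /andP[_ ij]; rewrite (ltn_eqF ij).
  rewrite add0n -[X in iota X]addn0 iotaDl -map_comp; apply: eq_map => i /=.
  by rewrite gtn_eqF // addn1 ltnS leq_addr.
rewrite e in r1.
apply: (rst_trans _ _ _ _ _ (reduces_equivalent (reduces_trans r1 (row_singles _ _)) (closed_row _))).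
exact: row_nil_equivalent.
Qed.

Lemma tr_even xs j : j < size xs ->
  (forall i, i < size xs -> odd (nth 0 xs i) = (i != j)) ->
  tr (pretzel_row xs) =
    Some (nth 0 xs j + \sum_(0 <= i < size xs | i != j) (nth 0 xs i - 1)).
Proof.
move=> jk oxs; apply: tr_eq => [|d]; last exact: tr_even_lower.
apply/trivializable_pretzelP; exists (even_stacks xs j); split.
- apply: (eq_from_nth (x0 := 0)); rewrite size_map size_mkseq // => i ik.
  rewrite (nth_map [::]) ?size_mkseq // nth_mkseq //; case: eqVneq => [->|ij].
    by rewrite size_alternating.
  by rewrite /= size_alternating prednK // odd_gt0 // oxs.
- rewrite !sumnE big_map (big_nth 0) (bigD1_seq j) ?iota_uniq ?mem_index_iota //=.
  rewrite [X in _ = X + _](big_nth [::]) size_mkseq (bigD1_seq j) ?iota_uniq ?mem_index_iota //=.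
  rewrite nth_mkseq // eqxx undecided_alternating add0n addnCA -big_split /=; congr (_ + _).
  rewrite big_nat_cond [RHS]big_nat_cond; apply: eq_bigr => i /andP[/andP[_ ik] ij].
  rewrite nth_mkseq // (negbTE ij) /undecided /= -/(undecided _) undecided_alternating.
  by rewrite addn0 subnKC // odd_gt0 // oxs.
- by left; apply: K_trivial_even_stack.
Qed.

Theorem theorem12 (m n : nat) (x : m.-tuple nat) (y : n.-tuple nat)
  (hx : forall i : 'I_m, tnth x i = 1)
  (hy : forall j : 'I_n, 2 <= tnth y j)
  (hP : two_bouquet (pretzel (x ++ y))) :
  [/\ n = 0 -> tr (pretzel (x ++ y)) = Some (2 * (m %/ 2)),
      forall j : 'I_n, ~~ odd (tnth y j) ->
        tr (pretzel (x ++ y)) =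
          Some (tnth y j + \sum_(i < n | i != j) (tnth y i - 1))
    & 0 < n -> (forall j : 'I_n, odd (tnth y j)) ->
        tr (pretzel (x ++ y)) =
          Some (2 * ((m + n) %/ 2) + \sum_(j < n) (tnth y j - 1))].
Proof.
have x1 : x = nseq m 1 :> seq nat.
  apply: (@eq_from_nth _ 0); rewrite size_tuple ?size_nseq // => i im.
  by rewrite nth_nseq im -(tnth_nth _ x (Ordinal im)) hx.
have sxy : size (x ++ y) = m + n by rewrite size_cat !size_tuple.
have prow : 0 < m + n -> pretzel (x ++ y) = pretzel_row (x ++ y).
  by rewrite -sxy /pretzel; case: (_ ++ _).
(* Stated without [0 < n], this also settles rows consisting only of ones. *)
have odd_case : 0 < m + n -> (forall j : 'I_n, odd (tnth y j)) ->
    tr (pretzel (x ++ y)) = Some (2 * ((m + n) %/ 2) + \sum_(j < n) (tnth y j - 1)).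
  move=> mn oy; rewrite prow //.
  have oxy : all odd (x ++ y).
    rewrite all_cat x1 all_nseq orbT; apply/allP => _ /tnthP[j ->]; exact: oy.
  rewrite tr_odd ?sxy //; congr Some.
  have sy : sumn y = n + \sum_(j < n) (tnth y j - 1).
    have sn : \sum_(j < n) 1 = n by rewrite sum1_card card_ord.
    rewrite -[X in _ = X + _]sn sumnE big_tuple -big_split.
    by apply: eq_bigr => j _ /=; rewrite subnKC // ltnW.
  by rewrite sumn_cat x1 sumn_nseq mul1n sy addnA; case: ifP => omn; lia.
split=> [n0|j ej|n0 oy].
- case: (posnP m) => [m0|m0].
    (* The diagram without precrossings is a single even stack of height 0. *)
    have -> : pretzel (x ++ y) = pretzel_row [:: 0].
      by rewrite /pretzel; case: (_ ++ _) sxy => //=; rewrite m0 n0.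
    by rewrite (@tr_even [:: 0] 0) // => [|[]//]; rewrite m0 /index_iota /= big_cons big_nil.
  have noj (j : 'I_n) : False by case: j => i; rewrite n0.
  rewrite odd_case ?addn_gt0 ?m0 //.
  by rewrite big1 ?addn0 ?n0 ?addn0 // => j; case: (noj j).
- have mn : 0 < m + n by rewrite addn_gt0 (leq_trans _ (ltn_ord j)) ?orbT.
  have nth_y i : i < n -> nth 0 (x ++ y) (m + i) = nth 0 y i.
    by move=> _; rewrite nth_cat size_tuple ltnNge leq_addr addKn.
  have jk : m + j < size (x ++ y) by rewrite sxy ltn_add2l.
  have ejk : ~~ odd (nth 0 (x ++ y) (m + j)) by rewrite nth_y // -tnth_nth.
  rewrite prow // pretzel_rowE in hP *.
  rewrite -pretzel_rowE (@tr_even _ (m + j)) //; last first.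
    (* Being a 2-bouquet forces every entry other than the even one to be odd. *)
    move=> i ik; case: eqVneq => [->|ij]; first exact/negbTE.
    have := bouquet_even hP; rewrite size_map => /(_ _ _ ik jk ij).
    by rewrite !(nth_map 0) // !size_nseq (negbTE ejk) orbF.
  rewrite nth_y // -tnth_nth sxy; congr (Some (_ + _)).
  (* The entries equal to 1 each contribute 1 - 1 = 0, so only the [y] part of the sum remains. *)
  rewrite (@big_cat_nat _ _ _ m) ?leq_addr //= big_nat_cond big1 ?add0n; last first.
    move=> i /andP[/andP[_ im] _].
    by rewrite nth_cat size_tuple im x1 nth_nseq im.
  rewrite -{1}[m]add0n big_addn addKn big_mkord.
  by apply: eq_big => [i|i _]; [rewrite [i + m]addnC eqn_add2l | rewrite [i + m]addnC nth_y // -tnth_nth].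
- by apply: odd_case; rewrite ?addn_gt0 ?n0 ?orbT.
Qed.
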